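(* Let $\mathbf{k}$ be a field and $p\in(0,\infty)$. (1) For real numbers $0\le a<b$ and $0\le c<d$, $$\mathbf{Tor}^{\ell^p_c}_1(\mathbf{k}[a,b),\mathbf{k}[c,d))\approx \mathbf{k}\big[\max(\|(b,c)\|_p,\|(a,d)\|_p),\ \|(b,d)\|_p\big),$$ and $\mathbf{Tor}^{\ell^p_c}_i(\mathbf{k}[a,b),\mathbf{k}[c,d))=0$ for $i\ge 2$. (2) $\mathbf{Tor}^{\ell^p_c}_i(\mathbf{k}[a,\infty),M)=\mathbf{Tor}^{\ell^p_c}_i(M,\mathbf{k}[a,\infty))=0$ for all $i\ge 1$, all $a\in\mathbb{R}_+$ and any persistence module $M:\mathbf{R}_+\to\mathbf{Vect}_{\mathbf{k}}$. (3) $\mathbf{Tor}^{\ell^\infty_c}_i(M,N)=0$ for $i\ge 1$ and any persistence modules $M,N:\mathbf{R}^n_+\to\mathbf{Vect}_{\mathbf{k}}$.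
   Context: $\mathbb{R}_+^n=\{x\in\mathbb{R}^n: x_i\ge 0\ \forall i\}$ with the product order, viewed as a category $\mathbf{R}^n_+$. A persistence module is a functor $\mathbf{R}^n_+\to\mathbf{Vect}_{\mathbf{k}}$; they form an abelian category (exactness pointwise) with enough projectives. For an interval $A\subseteq\mathbb{R}_+$, $\mathbf{k}[A]$ is the persistence module equal to $\mathbf{k}$ on $A$ and $0$ elsewhere, with identity maps inside $A$; we write $\mathbf{k}[a,b)$ for $\mathbf{k}[[a,b)]$, and $\mathbf{k}[x,y)=0$ if $x\ge y$. For $x,y\ge 0$: $\|(x,y)\|_p=(x^p+y^p)^{1/p}$ for $p\in(0,\infty)$ and $\|(x,y)\|_\infty=\max(x,y)$. For $p\in(0,\infty]$, $\ell^p_c:\mathbb{R}^n_+\times\mathbb{R}^n_+\to\mathbb{R}^n_+$ is the componentwise map $\ell^p_c(x,y)=(\|(x_1,y_1)\|_p,\dots,\|(x_n,y_n)\|_p)$. The tensor product is $(M\otimes_{\ell^p_c}N)_x=\operatorname{colim}_{\ell^p_c(a,b)\le x}M_a\otimes_{\mathbf{k}}N_b$; it is symmetric and right exact in each variable, and $\mathbf{Tor}^{\ell^p_c}_i$ are its left derived functors (apply $-\otimes_{\ell^p_c}N$ to a projective resolution of $M$ and take homology). *)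

(* Defs.v *)
From HB Require Import structures.
From mathcomp Require Import all_boot all_order all_algebra.
From mathcomp Require Import generic_quotient ring_quotient interval_inference.
From mathcomp Require Import boolp classical_sets reals ereal exp.
From mathcomp Require Import freeg.

Set Implicit Arguments.
Unset Strict Implicit.
Unset Printing Implicit Defensive.

Import Order.TTheory GRing.Theory Num.Theory.

Local Open Scope ring_scope.
Local Open Scope quotient_scope.

Section LinearAlgebra.
Variable k : fieldType.

Definition mklin (V W : lmodType k) (f : V -> W) (fL : linear f) :
  {linear V -> W} := HB.pack f (GRing.isLinear.Build k V W _ f fL).

Record subspace (V : lmodType k) := Subspace {
  subspace_set :> V -> Prop;
  subspace0 : subspace_set 0;
  subspaceP : forall c u v,
    subspace_set u -> subspace_set v -> subspace_set (c *: u + v) }.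

Section SubQuotient.
Variables (V : lmodType k) (W : subspace V).

Definition subspace_pred : {pred V} := fun v => `[< W v >].

Lemma subspace_predE v : (v \in subspace_pred) = `[< W v >]. Proof. by []. Qed.

Fact subspace_pred_closed : subsemimod_closed subspace_pred.
Proof.
have W0 := subspace0 W; have WP := @subspaceP V W.
split; last by move=> c v /asboolP Wv; apply/asboolP; rewrite -[c *: v]addr0; apply: WP.
split; first exact/asboolP.
move=> u v /asboolP Wu /asboolP Wv; apply/asboolP.
by rewrite -[u]scale1r; apply: WP.
Qed.

HB.instance Definition _ := GRing.isSubmodClosed.Build k V subspace_pred
  subspace_pred_closed.

Definition subspace_type : Type := {v : V | v \in subspace_pred}.
HB.instance Definition _ := SubChoice.on subspace_type.
HB.instance Definition _ := [SubChoice_isSubLmodule of subspace_type by <:].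

Definition lquot : Type := Quotient.quot subspace_pred.
HB.instance Definition _ := GRing.Zmodule.on lquot.
HB.instance Definition _ := Quotient.on lquot.

Definition lproj (v : V) : lquot := \pi_(Quotient.quot subspace_pred) v.

Lemma lproj_eqP (u v : V) : lproj u = lproj v <-> W (u - v).
Proof.
rewrite /lproj; split; first by move/eqP; rewrite -Quotient.idealrBE => /asboolP.
by move=> h; apply/eqP; rewrite -Quotient.idealrBE; apply/asboolP.
Qed.

Lemma lprojK (x : lquot) : lproj (repr x) = x. Proof. exact: reprK. Qed.

Lemma lprojD u v : lproj (u + v) = lproj u + lproj v.
Proof. by rewrite /lproj Quotient.pi_add. Qed.

Definition lquot_scale (c : k) (x : lquot) : lquot := lproj (c *: repr x).

Lemma lprojZ c u : lproj (c *: u) = lquot_scale c (lproj u).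
Proof.
apply/lproj_eqP; rewrite -scalerBr -[_ *: _]addr0.
by apply: subspaceP; [apply/lproj_eqP; rewrite lprojK|exact: subspace0].
Qed.

Fact lquot_scaleA a b v : lquot_scale a (lquot_scale b v) = lquot_scale (a * b) v.
Proof. by rewrite -[v]lprojK -!lprojZ scalerA. Qed.
Fact lquot_scale1 : left_id 1 lquot_scale.
Proof. by move=> v; rewrite -[v]lprojK -!lprojZ scale1r. Qed.
Fact lquot_scaleDr : right_distributive lquot_scale +%R.
Proof.
move=> c u v; rewrite -[u]lprojK -[v]lprojK -lprojD -!lprojZ -lprojD.
by rewrite scalerDr.
Qed.
Fact lquot_scaleDl v : {morph lquot_scale^~ v : a b / a + b}.
Proof. by move=> a b; rewrite -[v]lprojK -!lprojZ -lprojD scalerDl. Qed.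
HB.instance Definition _ := GRing.Zmodule_isLmodule.Build k lquot
  lquot_scaleA lquot_scale1 lquot_scaleDr lquot_scaleDl.

Fact lproj_linear : linear lproj.
Proof. by move=> c u v; rewrite lprojD lprojZ. Qed.
HB.instance Definition _ := GRing.isLinear.Build k V lquot _ lproj lproj_linear.

End SubQuotient.

Section Maps.
Variables (V V' : lmodType k) (W : subspace V) (W' : subspace V').
Variables (f : {linear V -> V'}) (fW : forall v, W v -> W' (f v)).

Fact sub_map_key (u : subspace_type W) : f (val u) \in subspace_pred W'.
Proof. by apply/asboolP/fW/asboolP/(valP u). Qed.
Fact sub_map_linear : linear (fun u : subspace_type W =>
  (exist _ (f (val u)) (sub_map_key u) : subspace_type W')).
Proof. by move=> c u v; apply: val_inj; rewrite /= linearP. Qed.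
Definition sub_map : {linear subspace_type W -> subspace_type W'} :=
  mklin sub_map_linear.

Fact quot_map_linear : linear (fun u : lquot W => lproj W' (f (repr u))).
Proof.
move=> c u v /=; rewrite -lproj_linear; apply/lproj_eqP.
rewrite -linearP -linearB; apply: fW.
by apply/lproj_eqP; rewrite lproj_linear !lprojK.
Qed.
Definition quot_map : {linear lquot W -> lquot W'} := mklin quot_map_linear.

Lemma quot_mapE v : quot_map (lproj W v) = lproj W' (f v).
Proof.
apply/lproj_eqP; rewrite -linearB; apply: fW.
by apply/lproj_eqP; rewrite lprojK.
Qed.

End Maps.

(* The free vector space on X; [fgen x] is the basis vector of x. *)
Definition free (X : Type) : lmodType k := {freeg {classic X} / k}.
Definition fgen (X : Type) (x : X) : free X := << (x : {classic X}) >>.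

Section FreeLift.
Variables (X : Type) (V : lmodType k) (f : X -> V).
Fact free_lift_linear : linear (@fglift k V {classic X} f : free X -> V).
Proof.
have fB : additive (@fglift k V {classic X} f : free X -> V).
  exact: lift_is_additive.
pose F : {additive free X -> V} := HB.pack (@fglift k V {classic X} f : free X -> V)
  (GRing.isZmodMorphism.Build _ _ _ fB).
have FE D : @fglift k V {classic X} f D = F D by [].
move=> c u v; rewrite !FE raddfD; congr (_ + _).
rewrite -[u in LHS]freeg_sumE -[u in RHS]freeg_sumE scaler_sumr !raddf_sum.
apply: eq_bigr => x _ /=.
have -> : c *: << (coeff x u) *g x >> = << (c * coeff x u) *g x >> :> free X.
  by apply/eqP/freeg_eqP => y; rewrite coeffZ !coeffU mulrA.
by rewrite !liftU scalerA.
Qed.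
Definition free_lift : {linear free X -> V} := mklin free_lift_linear.
Lemma free_liftE x : free_lift (fgen x) = f x.
Proof. by rewrite /= liftU scale1r. Qed.
End FreeLift.

Lemma free_ext X (V : lmodType k) (f g : {linear free X -> V}) :
  (forall x, f (fgen x) = g (fgen x)) -> f =1 g.
Proof.
move=> fg u; rewrite -[u]freeg_sumE !linear_sum; apply: eq_bigr => x _.
have -> : << (coeff x u) *g x >> = coeff x u *: fgen x :> free X.
  by apply/eqP/freeg_eqP => y; rewrite coeffZ !coeffU mul1r.
by rewrite !linearZ fg.
Qed.

Section Span.
Variables (V : lmodType k) (S : set V).
Local Open Scope classical_set_scope.
Definition span_set : set V := [set v | forall W : subspace V, S `<=` (W : V -> Prop) -> W v].
Fact span_set0 : span_set 0. Proof. by move=> W _; exact: subspace0. Qed.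
Fact span_setP c u v : span_set u -> span_set v -> span_set (c *: u + v).
Proof. by move=> hu hv W SW; apply: subspaceP; [exact: hu|exact: hv]. Qed.
Definition span := Subspace span_set0 span_setP.
End Span.

End LinearAlgebra.

Section Presented.
Variable k : fieldType.
Local Open Scope classical_set_scope.

(* The vector space with generators X and relations r = 0 for r in S. *)
Definition presented (X : Type) (S : set (free k X)) : lmodType k :=
  lquot (span S).

Definition pgen (X : Type) (S : set (free k X)) (x : X) : presented S :=
  lproj (span S) (fgen k x).

Lemma presented_ext X (S : set (free k X)) (V : lmodType k)
    (f g : {linear presented S -> V}) :
  (forall x, f (pgen S x) = g (pgen S x)) -> f =1 g.
Proof.
move=> fg u; rewrite -[u]lprojK.
exact: (@free_ext k X V (f \o lproj (span S)) (g \o lproj (span S))).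
Qed.

Section PresentedMap.
Variables (X Y : Type) (S : set (free k X)) (S' : set (free k Y)) (f : X -> Y).

Definition free_map : {linear free k X -> free k Y} :=
  free_lift (fun x => fgen k (f x)).

Hypothesis fS : forall r, S r -> span S' (free_map r).

Fact presented_map_key r : span S r -> span S' (free_map r).
Proof.
have W0 : span S' (free_map 0) by rewrite raddf0; exact: subspace0.
have WP c u v : span S' (free_map u) -> span S' (free_map v) ->
    span S' (free_map (c *: u + v)).
  by rewrite linearP; exact: subspaceP.
by move=> /(_ (Subspace W0 WP)); apply.
Qed.

Definition presented_map : {linear presented S -> presented S'} :=
  quot_map presented_map_key.

Lemma presented_mapE x : presented_map (pgen S x) = pgen S' (f x).
Proof. by rewrite /presented_map quot_mapE free_liftE. Qed.
End PresentedMap.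
End Presented.

(* V \otimes W: generators (v, w), relations expressing bilinearity. *)
Section VectorTensor.
Variable k : fieldType.

Variant tens_rel (V W : lmodType k) : free k (V * W) -> Prop :=
| tens_rel_l c v v' w : tens_rel
    (fgen k (c *: v + v', w) - (c *: fgen k (v, w) + fgen k (v', w)))
| tens_rel_r c v w w' : tens_rel
    (fgen k (v, c *: w + w') - (c *: fgen k (v, w) + fgen k (v, w'))).

Definition tens (V W : lmodType k) : lmodType k := presented (@tens_rel V W).
Definition tensv (V W : lmodType k) (v : V) (w : W) : tens V W :=
  pgen (@tens_rel V W) (v, w).

Section TensMap.
Variables (V V' W W' : lmodType k).
Variables (f : {linear V -> V'}) (g : {linear W -> W'}).

Fact tens_map_key r : tens_rel r ->
  span (@tens_rel V' W') (free_map k (fun vw => (f vw.1, g vw.2)) r).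
Proof.
move=> rr S; apply; case: rr => [c v v' w|c v w w'];
  rewrite linearB linearP !free_liftE /= linearP; constructor.
Qed.
Definition tens_map : {linear tens V W -> tens V' W'} :=
  presented_map tens_map_key.

Lemma tens_mapE v w : tens_map (tensv v w) = tensv (f v) (g w).
Proof. by rewrite /tens_map presented_mapE. Qed.
End TensMap.
End VectorTensor.

Arguments quot_map : simpl never.
Arguments tens_map : simpl never.

Section PersistenceModules.
Variable k : fieldType.

(* Functors from the poset T to the category of k-vector spaces. *)
Record pmod d (T : porderType d) := PMod {
  pm_obj :> T -> lmodType k;
  pm_tr : forall x y, (x <= y)%O -> {linear pm_obj x -> pm_obj y};
  pm_id : forall x (h : (x <= x)%O), pm_tr h =1 id;
  pm_comp : forall x y z (h : (x <= y)%O) (h' : (y <= z)%O) (h'' : (x <= z)%O),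
    pm_tr h'' =1 pm_tr h' \o pm_tr h }.

Record pmor d (T : porderType d) (M N : pmod T) := PMor {
  pm_fun :> forall x, {linear M x -> N x};
  pm_nat : forall x y (h : (x <= y)%O) m,
    pm_fun y (pm_tr M h m) = pm_tr N h (pm_fun x m) }.

Definition pm_zero d (T : porderType d) (M : pmod T) : Prop :=
  forall x (m : M x), m = 0.

Definition pm_iso d (T : porderType d) (M N : pmod T) : Prop :=
  exists (f : pmor M N) (g : pmor N M),
    forall x, cancel (f x) (g x) /\ cancel (g x) (f x).

Definition pm_epi d (T : porderType d) (M N : pmod T) (f : pmor M N) : Prop :=
  forall x (n : N x), exists m, f x m = n.

Definition pm_projective d (T : porderType d) (P : pmod T) : Prop :=
  forall (A B : pmod T) (e : pmor A B), pm_epi e -> forall f : pmor P B,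
  exists g : pmor P A, forall x p, e x (g x p) = f x p.

Fact zero_linear (V W : lmodType k) : linear (fun _ : V => 0 : W).
Proof. by move=> c u v; rewrite scaler0 addr0. Qed.

Section Basic.
Variables (d : Order.disp_t) (T : porderType d).

Fact pm_fzero_nat (M N : pmod T) x y (h : (x <= y)%O) (m : M x) :
  mklin (@zero_linear (M y) (N y)) (pm_tr M h m) =
  pm_tr N h (mklin (@zero_linear (M x) (N x)) m).
Proof. by rewrite /= raddf0. Qed.
Definition pm_fzero (M N : pmod T) : pmor M N := PMor (@pm_fzero_nat M N).

Fact pm_fid_nat (M : pmod T) x y (h : (x <= y)%O) (m : M x) :
  (idfun : {linear M y -> M y}) (pm_tr M h m) =
  pm_tr M h ((idfun : {linear M x -> M x}) m).
Proof. by []. Qed.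
Definition pm_fid (M : pmod T) : pmor M M := PMor (@pm_fid_nat M).

(* k[A]: the space of row vectors of length 1 on A and of length 0 off A; the
   1 x 1 matrix const_mx 1 is the identity. *)
Section IntervalModule.
Variable A : interval T.
Definition itv_obj (x : T) : lmodType k := 'rV[k]_(x \in A).
Definition itv_tr x y (h : (x <= y)%O) : {linear itv_obj x -> itv_obj y} :=
  mulmxr (const_mx 1).
Fact itv_tr_id x (h : (x <= x)%O) : itv_tr h =1 id.
Proof.
rewrite /itv_tr /itv_obj => v; apply/rowP => i; rewrite !mxE.
case: (x \in A) v i => v i; last by case: i.
by rewrite big_ord_recl big_ord0 mxE mulr1 addr0; congr (v _ _); rewrite [RHS]ord1.
Qed.
Fact itv_tr_comp x y z (h : (x <= y)%O) (h' : (y <= z)%O) (h'' : (x <= z)%O) :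
  itv_tr h'' =1 itv_tr h' \o itv_tr h.
Proof.
have yA : x \in A -> z \in A -> y \in A.
  case: A => l u; rewrite !itv_boundlr => /andP[lx _] /andP[_ zu].
  by rewrite (le_trans lx) ?(le_trans _ zu) ?bnd_simp.
rewrite /itv_tr /itv_obj => v; rewrite /= -mulmxA; congr (_ *m _).
apply/matrixP => i j; rewrite !mxE.
case: (x \in A) yA i v => [|_ []//]; case: (z \in A) j => [j|[]//].
by move=> ->// i v; rewrite big_ord_recl big_ord0 !mxE mulr1 addr0.
Qed.
Definition itv_mod : pmod T := PMod itv_tr_id itv_tr_comp.
End IntervalModule.

(* Ker g / (Im f :&: Ker g) at B. *)
Section Homology.
Variables (A B C : pmod T) (f : pmor A B) (g : pmor B C).

Fact ker_set0 x : g x 0 = 0. Proof. exact: raddf0. Qed.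
Fact ker_setP x c u v : g x u = 0 -> g x v = 0 -> g x (c *: u + v) = 0.
Proof. by move=> gu gv; rewrite linearP gu gv scaler0 addr0. Qed.
Definition cycles x : subspace (B x) := Subspace (@ker_set0 x) (@ker_setP x).

Definition im_set x (u : subspace_type (cycles x)) : Prop :=
  exists a, f x a = val u.
Fact im_set0 x : @im_set x 0.
Proof. by exists 0; rewrite !raddf0. Qed.
Fact im_setP x c u v : @im_set x u -> @im_set x v -> im_set (c *: u + v).
Proof. by move=> [a au] [b bv]; exists (c *: a + b); rewrite !linearP au bv. Qed.
Definition boundaries x : subspace (subspace_type (cycles x)) :=
  Subspace (@im_set0 x) (@im_setP x).

Definition hom_obj x : lmodType k := lquot (boundaries x).

Fact cycles_tr x y (h : (x <= y)%O) u : cycles x u -> cycles y (pm_tr B h u).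
Proof. by rewrite /= => gu; rewrite pm_nat gu raddf0. Qed.
Fact boundaries_tr x y (h : (x <= y)%O) u :
  boundaries x u -> boundaries y (sub_map (cycles_tr h) u).
Proof. by move=> [a au]; exists (pm_tr A h a); rewrite pm_nat au. Qed.
Definition hom_tr x y (h : (x <= y)%O) : {linear hom_obj x -> hom_obj y} :=
  quot_map (boundaries_tr h).

Arguments hom_tr : simpl never.
Lemma hom_trE x y (h : (x <= y)%O) u :
  hom_tr h (lproj (boundaries x) u) = lproj (boundaries y) (sub_map (cycles_tr h) u).
Proof. exact: quot_mapE. Qed.

Fact hom_tr_id x (h : (x <= x)%O) : hom_tr h =1 id.
Proof.
move=> u; rewrite -[u]lprojK hom_trE; congr lproj.
by apply: val_inj; rewrite /= pm_id.
Qed.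
Fact hom_tr_comp x y z (h : (x <= y)%O) (h' : (y <= z)%O) (h'' : (x <= z)%O) :
  hom_tr h'' =1 hom_tr h' \o hom_tr h.
Proof.
move=> u; rewrite -[u]lprojK /comp !hom_trE; congr lproj.
by apply: val_inj; rewrite /= (pm_comp h h').
Qed.
Definition homology : pmod T := PMod hom_tr_id hom_tr_comp.
End Homology.
End Basic.

(* The external tensor product M_a \otimes N_b, a functor on the product poset. *)
Section External.
Variables (d d' : Order.disp_t) (T : porderType d) (T' : porderType d').
Variables (M : pmod T) (N : pmod T').

Definition ext_obj (ab : T *p T') : lmodType k := tens (M ab.1) (N ab.2).

Fact le_fst (x y : T *p T') : (x <= y)%O -> (x.1 <= y.1)%O.
Proof. by case/andP. Qed.
Fact le_snd (x y : T *p T') : (x <= y)%O -> (x.2 <= y.2)%O.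
Proof. by case/andP. Qed.

Definition ext_tr x y (h : (x <= y)%O) : {linear ext_obj x -> ext_obj y} :=
  tens_map (pm_tr M (le_fst h)) (pm_tr N (le_snd h)).
Lemma ext_trE x y (h : (x <= y)%O) m n :
  ext_tr h (tensv m n) = tensv (pm_tr M (le_fst h) m) (pm_tr N (le_snd h) n).
Proof. exact: tens_mapE. Qed.

Fact ext_tr_id x (h : (x <= x)%O) : ext_tr h =1 id.
Proof.
apply: (presented_ext (g := idfun)) => -[m n].
by rewrite [LHS]ext_trE !pm_id.
Qed.
Fact ext_tr_comp x y z (h : (x <= y)%O) (h' : (y <= z)%O) (h'' : (x <= z)%O) :
  ext_tr h'' =1 ext_tr h' \o ext_tr h.
Proof.
apply: presented_ext => -[m n]; rewrite [LHS]ext_trE.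
rewrite [RHS](congr1 (ext_tr h') (ext_trE h m n)) [RHS]ext_trE.
by rewrite (pm_comp (le_fst h) (le_fst h')) (pm_comp (le_snd h) (le_snd h')).
Qed.
Definition ext : pmod (T *p T')%type := PMod ext_tr_id ext_tr_comp.
End External.

Section ExternalMap.
Variables (d d' : Order.disp_t) (T : porderType d) (T' : porderType d').
Variables (M M' : pmod T) (N N' : pmod T') (f : pmor M M') (g : pmor N N').
Definition ext_map_fun (ab : T *p T') : {linear ext M N ab -> ext M' N' ab} :=
  tens_map (f ab.1) (g ab.2).
Lemma ext_map_funE ab m n :
  ext_map_fun ab (tensv m n) = tensv (f ab.1 m) (g ab.2 n).
Proof. exact: tens_mapE. Qed.

Fact ext_map_nat x y (h : (x <= y)%O) (m : ext M N x) :
  ext_map_fun y (pm_tr (ext M N) h m) = pm_tr (ext M' N') h (ext_map_fun x m).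
Proof.
move: m; apply: (presented_ext (f := ext_map_fun y \o pm_tr (ext M N) h)
  (g := pm_tr (ext M' N') h \o ext_map_fun x)) => -[m n].
rewrite [LHS](congr1 (ext_map_fun y) (ext_trE h m n)) [LHS]ext_map_funE.
rewrite [RHS](congr1 (pm_tr (ext M' N') h) (ext_map_funE m n)) [RHS]ext_trE.
by rewrite !pm_nat.
Qed.
Definition ext_map : pmor (ext M N) (ext M' N') := PMor ext_map_nat.
End ExternalMap.

(* The colimit of the restriction of F to the subposet {j | P j}: generators
   the vectors of the F j with P j, relations expressing linearity in each F j
   and compatibility with the transition maps. *)
Section Colimit.
Variables (d : Order.disp_t) (J : porderType d).

Record cgen_type (F : J -> lmodType k) (P : pred J) :=
  CGen { cgen_idx : J; cgen_in : P cgen_idx; cgen_vec : F cgen_idx }.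

Section Def.
Variables (F : pmod J) (P : pred J).

Local Notation gen h v := (fgen k (@CGen F P _ h v)).

Variant colim_rel : free k (cgen_type F P) -> Prop :=
| colim_rel_lin j (h : P j) c u v : colim_rel
    (gen h (c *: u + v) - (c *: gen h u + gen h v))
| colim_rel_tr i j (hi : P i) (hj : P j) (ij : (i <= j)%O) v : colim_rel
    (gen hj (pm_tr F ij v) - gen hi v).

Definition colim : lmodType k := presented colim_rel.
Definition colim_in j (h : P j) (v : F j) : colim :=
  pgen colim_rel (@CGen F P j h v).
End Def.

Section Map.
Variables (F G : pmod J) (P Q : pred J).
Variables (f : pmor F G) (PQ : forall j, P j -> Q j).

Definition cgen_map (s : cgen_type F P) : cgen_type G Q :=
  CGen (PQ (cgen_in s)) (f _ (cgen_vec s)).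
Fact colim_map_key r : colim_rel r ->
  span (@colim_rel G Q) (free_map k cgen_map r).
Proof.
move=> rr S; apply; case: rr => [j h c u v|i j hi hj ij v].
  by rewrite linearB linearP !free_liftE /cgen_map /= linearP; constructor.
by rewrite linearB !free_liftE /cgen_map /= pm_nat; constructor.
Qed.
Definition colim_map : {linear colim F P -> colim G Q} :=
  presented_map colim_map_key.
Lemma colim_mapE j (h : P j) v :
  colim_map (colim_in h v) = colim_in (PQ h) (f j v).
Proof. by rewrite [LHS]presented_mapE. Qed.
End Map.
End Colimit.
Arguments colim_map : simpl never.

(* (M \otimes_l N)_x is the colimit of M_a \otimes N_b over l a b <= x. *)
Section Tensor.
Variables (d : Order.disp_t) (T : porderType d) (l : T -> T -> T).

Definition below (x : T) : pred (T *p T) := fun ab => (l ab.1 ab.2 <= x)%O.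
Fact belowS x y (h : (x <= y)%O) ab : below x ab -> below y ab.
Proof. by move=> /le_trans; apply. Qed.

Section Obj.
Variables (M N : pmod T).
Definition tensor_obj (x : T) : lmodType k := colim (ext M N) (below x).
Definition tensor_tr x y (h : (x <= y)%O) : {linear tensor_obj x -> tensor_obj y} :=
  colim_map (pm_fid (ext M N)) (belowS h).
Lemma tensor_trE x y (h : (x <= y)%O) ab (i : below x ab) v :
  tensor_tr h (colim_in i v) = colim_in (belowS h i) v.
Proof. exact: colim_mapE. Qed.

Fact tensor_tr_id x (h : (x <= x)%O) : tensor_tr h =1 id.
Proof.
apply: (presented_ext (g := idfun)) => -[ab i v].
rewrite [LHS]tensor_trE; congr colim_in; exact: bool_irrelevance.
Qed.
Fact tensor_tr_comp x y z (h : (x <= y)%O) (h' : (y <= z)%O) (h'' : (x <= z)%O) :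
  tensor_tr h'' =1 tensor_tr h' \o tensor_tr h.
Proof.
apply: presented_ext => -[ab i v]; rewrite [LHS]tensor_trE.
rewrite [RHS](congr1 (tensor_tr h') (tensor_trE h i v)) [RHS]tensor_trE.
congr colim_in; exact: bool_irrelevance.
Qed.
Definition tensor : pmod T := PMod tensor_tr_id tensor_tr_comp.
End Obj.

Section Map.
Variables (M M' N N' : pmod T) (f : pmor M M') (g : pmor N N').
Definition tensor_map_fun x : {linear tensor M N x -> tensor M' N' x} :=
  colim_map (ext_map f g) (fun ab (h : below x ab) => h).
Lemma tensor_map_funE x ab (i : below x ab) v :
  tensor_map_fun x (colim_in i v) = colim_in i (ext_map f g ab v).
Proof. exact: colim_mapE. Qed.

Fact tensor_map_nat x y (h : (x <= y)%O) (m : tensor M N x) :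
  tensor_map_fun y (pm_tr (tensor M N) h m) =
  pm_tr (tensor M' N') h (tensor_map_fun x m).
Proof.
move: m; apply: (presented_ext (f := tensor_map_fun y \o pm_tr (tensor M N) h)
  (g := pm_tr (tensor M' N') h \o tensor_map_fun x)) => -[ab i v].
rewrite [LHS](congr1 (tensor_map_fun y) (tensor_trE h i v)) [LHS]tensor_map_funE.
rewrite [RHS](congr1 (pm_tr (tensor M' N') h) (tensor_map_funE i v)).
by rewrite [RHS]tensor_trE.
Qed.
Definition tensor_map : pmor (tensor M N) (tensor M' N') := PMor tensor_map_nat.
End Map.
End Tensor.

Section Resolutions.
Variables (d : Order.disp_t) (T : porderType d).

Definition pm_exact (A B C : pmod T) (f : pmor A B) (g : pmor B C) : Prop :=
  forall x (b : B x), g x b = 0 <-> exists a, f x a = b.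

Record projective_resolution (M : pmod T) := ProjectiveResolution {
  res_obj :> nat -> pmod T;
  res_d : forall n, pmor (res_obj n.+1) (res_obj n);
  res_aug : pmor (res_obj 0) M;
  res_proj : forall n, pm_projective (res_obj n);
  res_aug_epi : pm_epi res_aug;
  res_exact0 : pm_exact (res_d 0) res_aug;
  res_exact : forall n, pm_exact (res_d n.+1) (res_d n) }.

(* The direct sum of the modules k[a, oo) over all m in M_a. *)
Section FreeCover.
Variable M : pmod T.

Record cover_gen (x : T) :=
  CoverGen { cg_pos : T; cg_le : (cg_pos <= x)%O; cg_vec : M cg_pos }.
Definition cover_gen_map x y (h : (x <= y)%O) (s : cover_gen x) : cover_gen y :=
  CoverGen (le_trans (cg_le s) h) (cg_vec s).

Definition cover_obj (x : T) : lmodType k := free k (cover_gen x).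
Definition cover_tr x y (h : (x <= y)%O) : {linear cover_obj x -> cover_obj y} :=
  free_map k (cover_gen_map h).
Lemma cover_trE x y (h : (x <= y)%O) s :
  cover_tr h (fgen k s) = fgen k (cover_gen_map h s).
Proof. exact: free_liftE. Qed.
Fact cover_tr_id x (h : (x <= x)%O) : cover_tr h =1 id.
Proof.
apply: (free_ext (g := idfun)) => -[a i v]; rewrite [LHS]cover_trE.
congr fgen; congr CoverGen; exact: bool_irrelevance.
Qed.
Fact cover_tr_comp x y z (h : (x <= y)%O) (h' : (y <= z)%O) (h'' : (x <= z)%O) :
  cover_tr h'' =1 cover_tr h' \o cover_tr h.
Proof.
apply: free_ext => -[a i v]; rewrite [LHS]cover_trE.
rewrite [RHS](congr1 (cover_tr h') (cover_trE h _)) [RHS]cover_trE.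
congr fgen; congr CoverGen; exact: bool_irrelevance.
Qed.
Definition cover : pmod T := PMod cover_tr_id cover_tr_comp.

Definition cover_map_fun x : {linear cover x -> M x} :=
  free_lift (fun s => pm_tr M (cg_le s) (cg_vec s)).
Lemma cover_map_funE x s :
  cover_map_fun x (fgen k s) = pm_tr M (cg_le s) (cg_vec s).
Proof. exact: free_liftE. Qed.
Fact cover_map_nat x y (h : (x <= y)%O) (m : cover x) :
  cover_map_fun y (pm_tr cover h m) = pm_tr M h (cover_map_fun x m).
Proof.
move: m; apply: (free_ext (f := cover_map_fun y \o pm_tr cover h)
  (g := pm_tr M h \o cover_map_fun x)) => -[a i v].
rewrite [LHS](congr1 (cover_map_fun y) (cover_trE h _)) [LHS]cover_map_funE.
rewrite [RHS](congr1 (pm_tr M h) (cover_map_funE _)).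
by rewrite -[RHS](pm_comp i h (le_trans i h)).
Qed.
Definition cover_map : pmor cover M := PMor cover_map_nat.

Lemma cover_map_epi : pm_epi cover_map.
Proof.
move=> x m; exists (fgen k (CoverGen (lexx x) m)).
by rewrite [LHS]cover_map_funE pm_id.
Qed.

Lemma cover_projective : pm_projective cover.
Proof.
move=> A B e e_epi f.
pose t (s : {a : T & M a}) := sval (cid
  (e_epi _ (f _ (fgen k (CoverGen (lexx (tag s)) (tagged s)))))).
have tE s : e _ (t s) = f _ (fgen k (CoverGen (lexx (tag s)) (tagged s))).
  by rewrite /t; case: cid.
pose g x : {linear cover x -> A x} := free_lift (fun s : cover_gen x =>
  pm_tr A (cg_le s) (t (Tagged (fun a => M a : Type) (cg_vec s)))).
have gE x s : g x (fgen k s) =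
    pm_tr A (cg_le s) (t (Tagged (fun a => M a : Type) (cg_vec s))).
  exact: free_liftE.
have g_nat x y (h : (x <= y)%O) (m : cover x) :
    g y (pm_tr cover h m) = pm_tr A h (g x m).
  move: m; apply: (free_ext (f := g y \o pm_tr cover h)
    (g := pm_tr A h \o g x)) => -[a i v].
  rewrite [LHS](congr1 (g y) (cover_trE h _)) [LHS]gE.
  rewrite [RHS](congr1 (pm_tr A h) (gE _ _)).
  by rewrite -[RHS](pm_comp i h (le_trans i h)).
exists (PMor g_nat) => x.
apply: (free_ext (f := e x \o g x) (g := f x)) => -[a i v].
rewrite [LHS](congr1 (e x) (gE _ _)) pm_nat.
rewrite [LHS](congr1 (pm_tr B i) (tE (Tagged (fun a => M a : Type) v))).
rewrite -[LHS]pm_nat; congr (f x _).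
rewrite [LHS]cover_trE; congr fgen; congr CoverGen; exact: bool_irrelevance.
Qed.
End FreeCover.

Section Kernel.
Variables (M N : pmod T) (f : pmor M N).
Definition kernel_obj x : lmodType k := subspace_type (cycles f x).
Definition kernel_tr x y (h : (x <= y)%O) :
  {linear kernel_obj x -> kernel_obj y} := sub_map (@cycles_tr _ _ _ _ f x y h).
Fact kernel_tr_id x (h : (x <= x)%O) : kernel_tr h =1 id.
Proof. by move=> u; apply: val_inj; rewrite /= pm_id. Qed.
Fact kernel_tr_comp x y z (h : (x <= y)%O) (h' : (y <= z)%O) (h'' : (x <= z)%O) :
  kernel_tr h'' =1 kernel_tr h' \o kernel_tr h.
Proof. by move=> u; apply: val_inj; rewrite /= (pm_comp h h'). Qed.
Definition kernel : pmod T := PMod kernel_tr_id kernel_tr_comp.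
End Kernel.

Section KernelInclusion.
Variables (M N L : pmod T) (f : pmor M N) (e : pmor L (kernel f)).
Fact kernel_incl_linear x :
  linear (fun u : L x => val (e x u : subspace_type (cycles f x))).
Proof. by move=> c u v; rewrite !linearP. Qed.
Fact kernel_incl_nat x y (h : (x <= y)%O) (u : L x) :
  mklin (@kernel_incl_linear y) (pm_tr L h u) =
  pm_tr M h (mklin (@kernel_incl_linear x) u).
Proof. by rewrite /= pm_nat. Qed.
Definition kernel_incl : pmor L M := PMor kernel_incl_nat.

Lemma kernel_incl_exact : pm_epi e -> pm_exact kernel_incl f.
Proof.
move=> e_epi x b; split=> [fb|[a <-]]; last exact/asboolP/(valP (e x a)).
have bK : b \in subspace_pred (cycles f x) by exact/asboolP.
have [a ea] := e_epi x (exist _ b bK : subspace_type (cycles f x)).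
by exists a; rewrite /= ea.
Qed.
End KernelInclusion.

Lemma pm_exact_incl (A M N L : pmod T) (g : pmor A L) (f : pmor M N)
    (e : pmor L (kernel f)) : pm_exact g e -> pm_exact g (kernel_incl e).
Proof.
move=> ge x b; rewrite -ge; split=> [eb|eb]; last by rewrite /= eb.
by apply: val_inj; rewrite [LHS]eb.
Qed.

Fixpoint syzygy (M : pmod T) (n : nat) : pmod T :=
  if n is m.+1 then kernel (cover_map (syzygy M m)) else M.

Lemma enough_projectives (M : pmod T) : inhabited (projective_resolution M).
Proof.
pose P n := cover (syzygy M n).
pose D n : pmor (P n.+1) (P n) := kernel_incl (cover_map (syzygy M n.+1)).
constructor; apply: (@ProjectiveResolution M P D (cover_map M)).
- by move=> n; exact: cover_projective.
- exact: cover_map_epi.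
- exact/kernel_incl_exact/cover_map_epi.
- move=> n; apply: (@pm_exact_incl (P n.+2) (P n) (syzygy M n) (P n.+1)).
  exact/kernel_incl_exact/cover_map_epi.
Qed.

Definition chosen_resolution (M : pmod T) : projective_resolution M :=
  inhabited_witness (enough_projectives M).

(* Tor_i(M, N) is the homology of P \otimes_l N in degree i; the complex ends
   with the zero map in degree 0. *)
Definition Tor (l : T -> T -> T) (i : nat) (M N : pmod T) : pmod T :=
  let P := chosen_resolution M in
  let d n := tensor_map l (res_d P n) (pm_fid N) in
  if i is j.+1 then homology (d j.+1) (d j)
  else homology (d 0) (pm_fzero (tensor l (P 0) N) (tensor l (P 0) N)).

End Resolutions.
End PersistenceModules.

Section PNorm.
Variable R : realType.

(* ||(x, y)||_p for p in ]0, +oo]; the value at other p is not used. *)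
Definition pnorm (p : \bar R) (x y : {nonneg R}) : {nonneg R} :=
  match p with
  | r%:E => NngNum (powR_ge0 (x%:num `^ r + y%:num `^ r) r^-1)
  | _ => Order.max x y
  end.

(* R_+^n is the type of n-tuples of {nonneg R} with the product order. *)
Definition lpc (p : \bar R) (n : nat) (x y : n.-tupleprod {nonneg R}) :
    n.-tupleprod {nonneg R} :=
  [tuple pnorm p (tnth x i) (tnth y i) | i < n].
End PNorm.

(* Main.v *)
From mathcomp Require Import all_boot all_order all_algebra.
From mathcomp Require Import interval_inference boolp classical_sets.
From mathcomp Require Import reals ereal exp.
Require Import Defs.
Import Order.TTheory GRing.Theory Num.Theory.

(** Since any two projective resolutions of a module are homotopy equivalent,
    and the tensor product is additive, Tor can be computed from a convenient
    resolution (Tor_resolution). The module k[a, oo) is projective, and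
    0 -> k[b, oo) -> k[a, oo) resolves k[a, b). Hence the Tor of k[a, oo) with
    anything vanishes in positive degree (Tor_rep), the Tor of k[a, b) with
    anything vanishes from degree two on (Tor_ge2_two_term), and in degree one
    it is the kernel of the tensored inclusion.

    For a monotone operation l on a total order, the tensor product of k[a, oo)
    with k[c, d) is k[l(a, c), l(a, d)): it is spanned by the product of the two
    generators, which appears at l(a, c) and dies at l(a, d). The kernel in
    degree one is therefore the part of k[l(b, c), l(b, d)) where the target
    k[l(a, c), l(a, d)) is already zero, that is, beyond l(a, d)
    (Tor1_interval).

    The other vanishing statements are instances of flatness in the second
    variable (Tor_flat), by which any resolution stays exact. For finite p the
    set of s with |(s, a)|_p <= x is empty or has a greatest element m, so that
    the tensor product of P with k[a, oo) is 0 or P_m at x (tensor_exact_rep).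
    For p = oo the pairs below x have the greatest element (x, x), so that the
    tensor product at x is that of the vector spaces P_x and N_x; it is exact
    because exact sequences of vector spaces split (tensor_exact_join,
    exact_split). *)

Set Implicit Arguments.
Unset Strict Implicit.
Unset Printing Implicit Defensive.

Local Open Scope ring_scope.

(** * Exact sequences of vector spaces split *)

Section Splitting.
Variable k : fieldType.
Local Open Scope classical_set_scope.

Lemma subspace_opp (V : lmodType k) (K : subspace V) v : K v -> K (- v).
Proof.
by move=> Kv; rewrite -scaleN1r -[_ *: _]addr0; apply: subspaceP => //; apply: subspace0.
Qed.

Lemma subspace_add (V : lmodType k) (K : subspace V) u v : K u -> K v -> K (u + v).
Proof. by move=> Ku; rewrite -[u]scale1r; apply: subspaceP. Qed.

Lemma subspace_scale (V : lmodType k) (K : subspace V) c v : K v -> K (c *: v).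
Proof. by move=> Kv; rewrite -[_ *: _]addr0; apply: subspaceP => //; apply: subspace0. Qed.

(** A maximal set meeting K only in 0 and closed under linear combinations is
    a complement of K: if some v lay outside its sum with K, all multiples of
    v could be adjoined. *)
Lemma complement (V : lmodType k) (K : subspace V) : exists C : subspace V,
  (forall v, C v -> K v -> v = 0) /\
  (forall v, exists c x, [/\ C c, K x & v = c + x]).
Proof.
(* No zero is required of these sets, so that the union of the empty chain
   qualifies; it is put back in A' below. *)
pose indep (A : set V) := (forall c u v, A u -> A v -> A (c *: u + v)) /\
  (forall v, A v -> K v -> v = 0).
have [|A [[AP A0] Amax]] := @Zorn_bigcup V indep.
  move=> F Findep Ftot; split=> [c u v [X FX Xu] [Y FY Yv]|v [X FX Xv]].
    case: (Ftot X Y FX FY) => [XY|YX].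
      by exists Y => //; apply: (Findep Y FY).1 => //; apply: XY.
    by exists X => //; apply: (Findep X FX).1 => //; apply: YX.
  exact: (Findep X FX).2.
pose A' := [set v | v = 0 \/ A v].
have A'P c u v : A' u -> A' v -> A' (c *: u + v).
  move=> [->|Au] [->|Av].
  - by left; rewrite scaler0 addr0.
  - by right; rewrite scaler0 add0r.
  - right; have -> : c *: u + 0 = (c - 1) *: u + u :> V.
      by rewrite addr0 scalerBl scale1r subrK.
    exact: AP.
  - by right; apply: AP.
exists (Subspace (or_introl erefl : A' 0) A'P); split.
  by move=> v [//|Av]; apply: A0.
move=> v; apply: contrapT => nv.
pose B := [set w | exists c a, A' a /\ w = a + c *: v].
apply: (Amax B); first split.
- move=> w Aw; exists 0, w; split; first by right.
  by rewrite scale0r addr0.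
- move=> BA; apply: nv; exists v, 0; split; [right|exact: subspace0|by rewrite addr0].
  by apply: BA; exists 1, 0; split; [left|rewrite add0r scale1r].
- split=> [c _ _ [d [a [Aa ->]]] [d' [a' [Aa' ->]]]|_ [c [a [Aa ->]]] Kw].
    exists (c * d + d'), (c *: a + a'); split; first exact: (A'P _ _ _ Aa Aa').
    by rewrite scalerDr scalerA scalerDl addrACA.
  have [c0|c0] := eqVneq c 0.
    move: Kw; rewrite c0 scale0r addr0.
    by case: Aa => [//|Aa] Ka; apply: A0.
  case: nv; exists (- c^-1 *: a), (c^-1 *: (a + c *: v)); split.
  + rewrite -[_ *: a]addr0; exact: (A'P _ _ _ Aa (or_introl erefl)).
  + exact: subspace_scale.
  + by rewrite scalerDr scalerA mulVf // scale1r scaleNr addKr.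
Qed.

Lemma projection (V : lmodType k) (K : subspace V) : exists p : {linear V -> V},
  (forall v, K (p v)) /\ (forall v, K v -> p v = v).
Proof.
have [C [CK0 CK]] := complement K.
have exP v : exists x, K x /\ C (v - x).
  by have [c [x [Cc Kx ->]]] := CK v; exists x; rewrite addrK.
pose p v := sval (cid (exP v)).
have pP v : K (p v) /\ C (v - p v) by rewrite /p; case: cid.
have pE v x : K x -> C (v - x) -> p v = x.
  move=> Kx Cx; have [Kp Cp] := pP v; apply/eqP; rewrite -subr_eq0; apply/eqP.
  apply: CK0; last exact/subspace_add/subspace_opp.
  have -> : p v - x = (v - x) + - (v - p v) by rewrite opprB [RHS]addrC subrKA.
  exact/subspace_add/subspace_opp.
have pL : linear p.
  move=> c u v; have [Ku Cu] := pP u; have [Kv Cv] := pP v.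
  apply: pE; first exact: subspaceP.
  by rewrite opprD addrACA -scalerBr; exact: subspaceP.
exists (mklin pL); split=> v; first exact: (pP v).1.
by move=> Kv; apply: pE => //; rewrite subrr; apply: subspace0.
Qed.

(** Project the target onto the range of g, choose a preimage, and remove its
    component along the kernel of g: the result is independent of the choice,
    hence linear. *)
Lemma pseudo_inverse (V W : lmodType k) (g : {linear V -> W}) :
  exists s : {linear W -> V}, forall v, g (s (g v)) = g v.
Proof.
have im0 : exists v, g v = 0 by exists 0; rewrite raddf0.
have imP c u v : (exists a, g a = u) -> (exists a, g a = v) ->
    exists a, g a = c *: u + v.
  by move=> [a <-] [b <-]; exists (c *: a + b); rewrite linearP.
have [p [pim pid]] := projection (Subspace im0 imP).
have ker0 : g 0 = 0 by rewrite raddf0.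
have kerP c u v : g u = 0 -> g v = 0 -> g (c *: u + v) = 0.
  by move=> gu gv; rewrite linearP gu gv scaler0 addr0.
have [q [qker qid]] := projection (Subspace ker0 kerP).
pose pre w := sval (cid (pim w)).
have preE w : g (pre w) = p w by rewrite /pre; case: cid.
pose s w := pre w - q (pre w).
have sL : linear s.
  move=> c u v; rewrite /s.
  have kr : g (pre (c *: u + v) - (c *: pre u + pre v)) = 0.
    by rewrite linearB preE [g (_ + _)]linearP !preE [p _]linearP subrr.
  have := qid _ kr; rewrite linearB [q (_ + _)]linearP => qE.
  set a := pre (c *: u + v) in qE *; rewrite scalerBr addrACA -opprD.
  set X := _ + pre v in qE *; set Y := _ + q _ in qE *.
  have aE : a = X + (q a - Y) by rewrite qE addrC subrK.
  by move: a X Y (q a) aE {qE kr} => a X Y b ->; rewrite addrA addrAC addrK.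
exists (mklin sL) => v /=; rewrite linearB.
have -> : g (q (pre (g v))) = 0 by apply: qker.
by rewrite subr0 preE; apply: pid; exists v.
Qed.

(** The identity of the middle term factors through its two neighbours. An
    identity of this form survives every additive functor, which is how
    exactness passes to tensor products over a field. *)
Lemma exact_split (A B C : lmodType k) (f : {linear A -> B}) (g : {linear B -> C}) :
  (forall b, g b = 0 -> exists a, f a = b) ->
  exists (s : {linear C -> B}) (t : {linear B -> A}),
    forall b, b = s (g b) + f (t b).
Proof.
move=> fg; have [s gsg] := pseudo_inverse g; have [r frf] := pseudo_inverse f.
have tL : linear (fun b => r (b - s (g b))).
  move=> c u v; rewrite -linearP; congr (r _).
  by rewrite [g _]linearP [s _]linearP scalerBr opprD addrACA.
exists s, (mklin tL) => b /=.
have [|a fa] := fg (b - s (g b)); first by rewrite linearB gsg subrr.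
by rewrite -fa frf fa addrC subrK.
Qed.
End Splitting.

(** * Universal properties of quotients, tensor products and colimits *)

Section UniversalProperties.
Variable k : fieldType.

Section QuotientLift.
Variables (V U : lmodType k) (W : subspace V) (f : {linear V -> U}).
Hypothesis fW : forall v, W v -> f v = 0.

Fact lquot_lift_eq u v : lproj W u = lproj W v -> f u = f v.
Proof. by move=> /lproj_eqP /fW; rewrite linearB => /eqP; rewrite subr_eq0 => /eqP. Qed.
Fact lquot_lift_linear : linear (fun x : lquot W => f (repr x)).
Proof.
move=> c u v; rewrite -linearP; apply: lquot_lift_eq.
by rewrite lproj_linear !lprojK.
Qed.
Definition lquot_lift : {linear lquot W -> U} := mklin lquot_lift_linear.
Lemma lquot_liftE v : lquot_lift (lproj W v) = f v.
Proof. by apply: lquot_lift_eq; rewrite lprojK. Qed.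
End QuotientLift.

Lemma lproj_eq0 (V : lmodType k) (W : subspace V) v : lproj W v = 0 <-> W v.
Proof.
have -> : 0 = lproj W 0 by rewrite raddf0.
by split=> [/lproj_eqP|Wv]; [|apply/lproj_eqP]; rewrite subr0.
Qed.

Section PresentedLift.
Variables (X : Type) (S : set (free k X)) (V : lmodType k) (f : X -> V).
Hypothesis fS : forall r, S r -> free_lift f r = 0.

Fact presented_lift_key r : span S r -> free_lift f r = 0.
Proof.
have ker0 : free_lift f 0 = 0 by rewrite raddf0.
have kerP c u v : free_lift f u = 0 -> free_lift f v = 0 ->
    free_lift f (c *: u + v) = 0.
  by move=> fu fv; rewrite linearP fu fv scaler0 addr0.
by move=> /(_ (Subspace ker0 kerP)); apply.
Qed.
Definition presented_lift : {linear presented S -> V} :=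
  lquot_lift presented_lift_key.
Lemma presented_liftE x : presented_lift (pgen S x) = f x.
Proof. by rewrite [LHS]lquot_liftE free_liftE. Qed.
End PresentedLift.

Lemma pgen_rel X (S : set (free k X)) r : S r -> lproj (span S) r = 0.
Proof. by move=> Sr; apply/lproj_eq0 => W; apply. Qed.

Section Tens.
Variables (V W : lmodType k).

Lemma tensvPl c (v v' : V) (w : W) :
  tensv (c *: v + v') w = c *: tensv v w + tensv v' w.
Proof.
have := pgen_rel (tens_rel_l c v v' w).
by rewrite linearB linearP => /eqP; rewrite subr_eq0 => /eqP.
Qed.

Lemma tensvPr c (v : V) (w w' : W) :
  tensv v (c *: w + w') = c *: tensv v w + tensv v w'.
Proof.
have := pgen_rel (tens_rel_r c v w w').
by rewrite linearB linearP => /eqP; rewrite subr_eq0 => /eqP.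
Qed.

Lemma tensv0l (w : W) : tensv (0 : V) w = 0.
Proof. by have := tensvPl (-1) 0 0 w; rewrite scaler0 addr0 scaleN1r addNr. Qed.

Lemma tensv0r (v : V) : tensv v (0 : W) = 0.
Proof. by have := tensvPr (-1) v 0 0; rewrite scaler0 addr0 scaleN1r addNr. Qed.

Lemma tensvZl c (v : V) (w : W) : tensv (c *: v) w = c *: tensv v w.
Proof. by have := tensvPl c v 0 w; rewrite tensv0l !addr0. Qed.

Lemma tensvZr c (v : V) (w : W) : tensv v (c *: w) = c *: tensv v w.
Proof. by have := tensvPr c v w 0; rewrite tensv0r !addr0. Qed.

Variables (U : lmodType k) (b : V -> W -> U).
Hypothesis bl : forall c v v' w, b (c *: v + v') w = c *: b v w + b v' w.
Hypothesis br : forall c v w w', b v (c *: w + w') = c *: b v w + b v w'.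

Fact tens_lift_key r : tens_rel r -> free_lift (fun vw => b vw.1 vw.2) r = 0.
Proof.
by case=> [c v v' w|c v w w']; rewrite linearB linearP !free_liftE /=
  ?bl ?br subrr.
Qed.
Definition tens_lift : {linear tens V W -> U} := presented_lift tens_lift_key.
Lemma tens_liftE v w : tens_lift (tensv v w) = b v w.
Proof. exact: presented_liftE. Qed.
End Tens.

Section Colim.
Variables (d : Order.disp_t) (J : porderType d) (F : pmod k J) (P : pred J).

Fact colim_in_linear j (h : P j) : linear (fun v : F j => colim_in h v).
Proof.
move=> c u v; have := pgen_rel (colim_rel_lin (F := F) h c u v).
by rewrite linearB linearP => /eqP; rewrite subr_eq0 => /eqP.
Qed.
Definition colim_inl j (h : P j) : {linear F j -> colim F P} :=
  mklin (colim_in_linear h).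

Lemma colim_in_tr i j (hi : P i) (hj : P j) (ij : (i <= j)%O) v :
  colim_in hj (pm_tr F ij v) = colim_in hi v.
Proof.
have := pgen_rel (colim_rel_tr hi hj ij v).
by rewrite linearB => /eqP; rewrite subr_eq0 => /eqP.
Qed.

Lemma colim_spanned (W : subspace (colim F P)) :
  (forall j (h : P j) v, W (colim_in h v)) -> forall u, W u.
Proof.
move=> Wgen u; apply/lproj_eq0.
apply: (presented_ext (f := lproj W) (g := mklin (@zero_linear _ _ _))) => -[j h v].
exact/lproj_eq0/Wgen.
Qed.

Variables (V : lmodType k) (f : forall j, {linear F j -> V}).
Hypothesis f_tr : forall i j (hi : P i) (hj : P j) (ij : (i <= j)%O) v,
  f j (pm_tr F ij v) = f i v.

Fact colim_lift_key r : @colim_rel k d J F P r ->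
  free_lift (fun s : cgen_type F P => f (cgen_idx s) (cgen_vec s)) r = 0.
Proof.
case=> [j h c u v|i j hi hj ij v].
  by rewrite linearB linearP !free_liftE /= linearP subrr.
by rewrite linearB !free_liftE /= f_tr // subrr.
Qed.
Definition colim_lift : {linear colim F P -> V} := presented_lift colim_lift_key.
Lemma colim_liftE j (h : P j) v : colim_lift (colim_in h v) = f j v.
Proof. by rewrite [LHS]presented_liftE. Qed.
End Colim.

Section TensorGenerators.
Variables (d : Order.disp_t) (T : porderType d) (l : T -> T -> T).

Definition pure_tensor (M N : pmod k T) x ab (i : below l x ab) (m : M ab.1) (n : N ab.2) :
  tensor l M N x := colim_in (F := ext M N) i (tensv m n).

Lemma pure_tensor0l (M N : pmod k T) x ab (i : below l x ab) (n : N ab.2) :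
  pure_tensor i (0 : M ab.1) n = 0.
Proof. by rewrite /pure_tensor tensv0l; apply: (raddf0 (colim_inl _ _)). Qed.

Lemma pure_tensor0r (M N : pmod k T) x ab (i : below l x ab) (m : M ab.1) :
  pure_tensor i m (0 : N ab.2) = 0.
Proof. by rewrite /pure_tensor tensv0r; apply: (raddf0 (colim_inl _ _)). Qed.

Lemma pure_tensorZl (M N : pmod k T) x ab (i : below l x ab) c (m : M ab.1) (n : N ab.2) :
  pure_tensor i (c *: m) n = c *: pure_tensor i m n.
Proof. by rewrite /pure_tensor tensvZl; apply: (linearZ_LR (colim_inl _ _)). Qed.

Lemma pure_tensorZr (M N : pmod k T) x ab (i : below l x ab) c (m : M ab.1) (n : N ab.2) :
  pure_tensor i m (c *: n) = c *: pure_tensor i m n.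
Proof. by rewrite /pure_tensor tensvZr; apply: (linearZ_LR (colim_inl _ _)). Qed.

Lemma pure_tensorPl (M N : pmod k T) x ab (i : below l x ab) c (m m' : M ab.1) (n : N ab.2) :
  pure_tensor i (c *: m + m') n = c *: pure_tensor i m n + pure_tensor i m' n.
Proof. by rewrite /pure_tensor tensvPl; apply: (linearP (colim_inl _ _)). Qed.

Lemma pure_tensor_le (M N : pmod k T) x ab ab' (i : below l x ab) (i' : below l x ab')
    (h1 : (ab.1 <= ab'.1)%O) (h2 : (ab.2 <= ab'.2)%O) (m : M ab.1) (n : N ab.2) :
  pure_tensor i' (pm_tr M h1 m) (pm_tr N h2 n) = pure_tensor i m n.
Proof.
have h : ((ab : (T *p T)%type) <= ab')%O by apply/andP.
rewrite -[RHS](colim_in_tr (F := ext M N) i i' h).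
congr colim_in; rewrite [RHS]ext_trE; congr (tensv (pm_tr M _ m) (pm_tr N _ n));
  exact: bool_irrelevance.
Qed.

Lemma pure_tensor_tr (M N : pmod k T) x y (h : (x <= y)%O) ab (i : below l x ab)
    (m : M ab.1) (n : N ab.2) :
  pm_tr (tensor l M N) h (pure_tensor i m n) = pure_tensor (belowS h i) m n.
Proof. exact: tensor_trE. Qed.

Lemma tensor_mapE (M M' N N' : pmod k T) (f : pmor M M') (g : pmor N N') x ab
    (i : below l x ab) (m : M ab.1) (n : N ab.2) :
  tensor_map l f g x (pure_tensor i m n) = pure_tensor i (f _ m) (g _ n).
Proof. by rewrite [LHS]tensor_map_funE; congr colim_in; exact: ext_map_funE. Qed.

Lemma tensor_ext (M N : pmod k T) x (V : lmodType k)
    (f g : {linear tensor l M N x -> V}) :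
  (forall ab (i : below l x ab) m n, f (pure_tensor i m n) = g (pure_tensor i m n)) -> f =1 g.
Proof.
move=> fg; apply: presented_ext => -[ab i v]; move: v.
apply: (presented_ext (f := f \o colim_inl (ext M N) i)
  (g := g \o colim_inl (ext M N) i)) => -[m n].
exact: fg.
Qed.

Lemma tensor_spanned (M N : pmod k T) x (W : subspace (tensor l M N x)) :
  (forall ab (i : below l x ab) m n, W (pure_tensor i m n)) -> forall u, W u.
Proof.
move=> Wgen u; apply/lproj_eq0.
apply: (tensor_ext (f := lproj W) (g := mklin (@zero_linear _ _ _))) => ab i m n.
exact/lproj_eq0/Wgen.
Qed.

Section Lift.
Variables (M N : pmod k T) (x : T) (V : lmodType k).
Variable b : forall ab : (T *p T)%type, M ab.1 -> N ab.2 -> V.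
Hypothesis bl : forall ab c (v v' : M ab.1) (w : N ab.2),
  b (c *: v + v') w = c *: b v w + b v' w.
Hypothesis br : forall ab c (v : M ab.1) (w w' : N ab.2),
  b v (c *: w + w') = c *: b v w + b v w'.
Hypothesis b_tr : forall ab ab' (i : below l x ab) (i' : below l x ab')
  (h1 : (ab.1 <= ab'.1)%O) (h2 : (ab.2 <= ab'.2)%O) v w,
  @b ab' (pm_tr M h1 v) (pm_tr N h2 w) = @b ab v w.

Fact tensor_lift_key (ab ab' : (T *p T)%type) (i : below l x ab) (i' : below l x ab')
    (h : (ab <= ab')%O) (v : ext M N ab) :
  tens_lift (@bl ab') (@br ab') (pm_tr (ext M N) h v) = tens_lift (@bl ab) (@br ab) v.
Proof.
move: v; apply: (presented_ext
  (f := tens_lift (@bl ab') (@br ab') \o pm_tr (ext M N) h)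
  (g := tens_lift (@bl ab) (@br ab))) => -[m n].
rewrite [LHS](congr1 (tens_lift (@bl ab') (@br ab')) (ext_trE h m n)).
rewrite [LHS]tens_liftE [RHS]tens_liftE; exact: b_tr.
Qed.
(** The universal property of the tensor product of persistence modules, the
    main way to show that an element is nonzero: a family of bilinear maps,
    compatible with the transition maps of the index set only. *)
Definition tensor_lift : {linear tensor l M N x -> V} := colim_lift tensor_lift_key.
Lemma tensor_liftE ab (i : below l x ab) m n :
  tensor_lift (pure_tensor i m n) = b m n.
Proof. by rewrite [LHS]colim_liftE [LHS]tens_liftE. Qed.
End Lift.
End TensorGenerators.
End UniversalProperties.

(** * Comparison of projective resolutions *)

Section Morphisms.
Variables (k : fieldType) (d : Order.disp_t) (T : porderType d).
Implicit Types A B C M N P : pmod k T.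

Section Operations.
Variables A B C : pmod k T.

Fact pm_compose_nat (g : pmor B C) (f : pmor A B) x y (h : (x <= y)%O) (m : A x) :
  (g y \o f y) (pm_tr A h m) = pm_tr C h ((g x \o f x) m).
Proof. by rewrite /= !pm_nat. Qed.
Definition pm_compose (g : pmor B C) (f : pmor A B) : pmor A C :=
  PMor (@pm_compose_nat g f).

Fact pm_lincomb_linear (c : k) (f g : pmor A B) x :
  linear (fun m => c *: f x m + g x m).
Proof.
move=> e u v; rewrite [f x _]linearP [g x _]linearP !scalerDr !scalerA.
by rewrite [e * c]mulrC addrACA.
Qed.
Fact pm_lincomb_nat c (f g : pmor A B) x y (h : (x <= y)%O) (m : A x) :
  mklin (@pm_lincomb_linear c f g y) (pm_tr A h m) =
  pm_tr B h (mklin (@pm_lincomb_linear c f g x) m).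
Proof. by rewrite /= !pm_nat [RHS]linearP. Qed.
Definition pm_lincomb c (f g : pmor A B) : pmor A B := PMor (@pm_lincomb_nat c f g).
Lemma pm_lincombE c f g x m : pm_lincomb c f g x m = c *: f x m + g x m.
Proof. by []. Qed.
End Operations.

Section Submodule.
Variables (B : pmod k T) (W : forall x, subspace (B x)).
Hypothesis W_tr : forall x y (h : (x <= y)%O) v, W x v -> W y (pm_tr B h v).

Definition sub_obj x : lmodType k := subspace_type (W x).
Definition sub_tr x y (h : (x <= y)%O) : {linear sub_obj x -> sub_obj y} :=
  sub_map (@W_tr x y h).
Fact sub_tr_id x (h : (x <= x)%O) : sub_tr h =1 id.
Proof. by move=> u; apply: val_inj; rewrite /= pm_id. Qed.
Fact sub_tr_comp x y z (h : (x <= y)%O) (h' : (y <= z)%O) (h'' : (x <= z)%O) :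
  sub_tr h'' =1 sub_tr h' \o sub_tr h.
Proof. by move=> u; apply: val_inj; rewrite /= (pm_comp h h'). Qed.
Definition sub_pmod : pmod k T := PMod sub_tr_id sub_tr_comp.

Variables (A : pmod k T) (f : pmor A B).
Hypothesis fW : forall x a, W x (f x a).

Fact corestr_key x a : f x a \in subspace_pred (W x).
Proof. exact/asboolP. Qed.
Fact corestr_linear x :
  linear (fun a => exist _ (f x a) (corestr_key a) : sub_pmod x).
Proof. by move=> c u v; apply: val_inj; rewrite /= linearP. Qed.
Fact corestr_nat x y (h : (x <= y)%O) (a : A x) :
  mklin (@corestr_linear y) (pm_tr A h a) =
  pm_tr sub_pmod h (mklin (@corestr_linear x) a).
Proof. by apply: val_inj; rewrite /= pm_nat. Qed.
Definition corestr : pmor A sub_pmod := PMor corestr_nat.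
End Submodule.

Section Image.
Variables (A B : pmod k T) (f : pmor A B).
Fact range_set0 x : exists a, f x a = 0. Proof. by exists 0; rewrite raddf0. Qed.
Fact range_setP x c u v :
  (exists a, f x a = u) -> (exists a, f x a = v) -> exists a, f x a = c *: u + v.
Proof. by move=> [a <-] [b <-]; exists (c *: a + b); rewrite linearP. Qed.
Definition range_sub x : subspace (B x) :=
  Subspace (@range_set0 x) (@range_setP x).
Fact range_tr x y (h : (x <= y)%O) v :
  range_sub x v -> range_sub y (pm_tr B h v).
Proof. by move=> [a <-]; exists (pm_tr A h a); rewrite pm_nat. Qed.
End Image.

(** Lifting through a map that need not be epi: both maps are corestricted
    to the range of f. *)
Lemma projective_lift P A B (f : pmor A B) (g : pmor P B) : pm_projective P ->
  (forall x p, exists a, f x a = g x p) ->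
  exists h : pmor P A, forall x p, f x (h x p) = g x p.
Proof.
move=> Pproj fg.
have fW x a : range_sub f x (f x a) by exists a.
have [|h hP] := Pproj _ _ (corestr (@range_tr _ _ f) fW) _ (corestr (@range_tr _ _ f) fg).
  move=> x [b bW]; have /asboolP[a fa] := bW.
  by exists a; apply: val_inj.
by exists h => x p; have /(congr1 val) := hP x p.
Qed.
End Morphisms.

Lemma dependent_choice (S : nat -> Type) (r : forall n, S n -> S n.+1 -> Prop)
    (s0 : S 0) : (forall n s, exists s', @r n s s') ->
  exists F : forall n, S n, F 0 = s0 /\ forall n, r n (F n) (F n.+1).
Proof.
move=> rS; exists (nat_rect S s0 (fun n s => sval (cid (rS n s)))).
by split=> // n /=; case: cid.
Qed.

Section Comparison.
Variables (k : fieldType) (d : Order.disp_t) (T : porderType d).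
Implicit Types M N : pmod k T.

Definition chain_map M N (P : projective_resolution M) (Q : projective_resolution N)
    (f : forall n, pmor (P n) (Q n)) : Prop :=
  forall n x p, res_d Q n x (f n.+1 x p) = f n x (res_d P n x p).

Lemma res_aug_d M (P : projective_resolution M) x p :
  res_aug P x (res_d P 0 x p) = 0.
Proof. by apply/res_exact0; exists p. Qed.

Lemma res_dd M (P : projective_resolution M) n x p :
  res_d P n x (res_d P n.+1 x p) = 0.
Proof. by apply/res_exact; exists p. Qed.

Lemma lift_chain_map M (P Q : projective_resolution M) :
  exists f : forall n, pmor (P n) (Q n),
    chain_map f /\ forall x p, res_aug Q x (f 0%N x p) = res_aug P x p.
Proof.
(* f extends one step further exactly when it maps boundaries to boundaries. *)
pose S n := {f : pmor (P n) (Q n) |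
  forall x p, exists q, res_d Q n x q = f x (res_d P n x p)}.
have [f0 f0P] : exists f0 : pmor (P 0%N) (Q 0%N),
    forall x p, res_aug Q x (f0 x p) = res_aug P x p.
  apply: (projective_lift (f := res_aug Q) (g := res_aug P) (@res_proj _ _ _ _ P 0%N)) => x p.
  exact: res_aug_epi.
have f0S x p : exists q, res_d Q 0 x q = f0 x (res_d P 0 x p).
  by apply/res_exact0; rewrite f0P res_aug_d.
have [|F [F0 FP]] := @dependent_choice S (fun n s s' => forall x p,
  res_d Q n x (sval s' x p) = sval s x (res_d P n x p)) (exist _ f0 f0S).
  move=> n [f fS] /=.
  have [g gP] := projective_lift (f := res_d Q n) (g := pm_compose f (res_d P n))
    (@res_proj _ _ _ _ P n.+1) fS.
  have gS x p : exists q, res_d Q n.+1 x q = g x (res_d P n.+1 x p).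
    by apply/res_exact; rewrite gP /= res_dd raddf0.
  by exists (exist _ g gS).
by exists (fun n => sval (F n)); split=> [n x p|x p]; [exact: FP|rewrite F0].
Qed.

(** Two lifts of one map to resolutions are homotopic. The recursion carries
    only h_n with d h_n d = u_n d, where u = f - g; this makes u_(n+1) - h_n d
    a cycle without any reference to h_(n-1). *)
Lemma lift_homotopy M N (P : projective_resolution M) (Q : projective_resolution N)
    (f g : forall n, pmor (P n) (Q n)) :
  chain_map f -> chain_map g ->
  (forall x p, res_aug Q x (f 0%N x p) = res_aug Q x (g 0%N x p)) ->
  exists h : forall n, pmor (P n) (Q n.+1), forall n x p,
    f n.+1 x p = res_d Q n.+1 x (h n.+1 x p) + h n x (res_d P n x p) + g n.+1 x p.
Proof.
move=> fC gC fg0; pose u n := pm_lincomb (-1) (g n) (f n).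
have uE n x p : u n x p = f n x p - g n x p by rewrite /= scaleN1r addrC.
have uC n x p : res_d Q n x (u n.+1 x p) = u n x (res_d P n x p).
  by rewrite !uE linearB fC gC.
pose S n := {h : pmor (P n) (Q n.+1) |
  forall x p, res_d Q n x (h x (res_d P n x p)) = u n x (res_d P n x p)}.
have [h0 h0P] : exists h0 : pmor (P 0%N) (Q 1%N),
    forall x p, res_d Q 0 x (h0 x p) = u 0%N x p.
  apply: (projective_lift (f := res_d Q 0) (g := u 0%N) (@res_proj _ _ _ _ P 0%N)) => x p.
  by apply/res_exact0; rewrite uE linearB fg0 subrr.
have h0S x p : res_d Q 0 x (h0 x (res_d P 0 x p)) = u 0%N x (res_d P 0 x p).
  exact: h0P.
have [|F [F0 FP]] := @dependent_choice S (fun n s s' => forall x p,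
  res_d Q n.+1 x (sval s' x p) = u n.+1 x p - sval s x (res_d P n x p))
  (exist _ h0 h0S).
  move=> n [h hS] /=.
  pose v := pm_lincomb (-1) (pm_compose h (res_d P n)) (u n.+1).
  have vE x p : v x p = u n.+1 x p - h x (res_d P n x p).
    by rewrite /v [LHS]/= scaleN1r addrC.
  have [|g' gP] := projective_lift (f := res_d Q n.+1) (g := v) (@res_proj _ _ _ _ P n.+1).
    by move=> x p; apply/res_exact; rewrite vE linearB uC hS subrr.
  have gS x p : res_d Q n.+1 x (g' x (res_d P n.+1 x p)) = u n.+1 x (res_d P n.+1 x p).
    by rewrite gP vE res_dd raddf0 subr0.
  by exists (exist _ g' gS) => x p /=; rewrite gP vE.
exists (fun n => sval (F n)) => n x p.
by rewrite FP subrK uE subrK.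
Qed.
End Comparison.

Section HomologyIsomorphism.
Variables (k : fieldType) (d : Order.disp_t) (T : porderType d).
Variables (A B C A' B' C' : pmod k T).
Variables (f : pmor A B) (g : pmor B C) (f' : pmor A' B') (g' : pmor B' C').

Section Map.
Variable u : pmor B B'.
Hypothesis u_cycle : forall x b, g x b = 0 -> g' x (u x b) = 0.
Hypothesis u_bound : forall x a, exists a', f' x a' = u x (f x a).

Fact cycles_map x b : cycles g x b -> cycles g' x (u x b).
Proof. exact: u_cycle. Qed.
Fact hom_map_key x (b : subspace_type (cycles g x)) :
  boundaries f g x b -> boundaries f' g' x (sub_map (@cycles_map x) b).
Proof. by move=> [a fa]; have [a' fa'] := u_bound a; exists a'; rewrite fa' fa. Qed.
Definition hom_map_fun x : {linear homology f g x -> homology f' g' x} :=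
  quot_map (@hom_map_key x).
Lemma hom_map_funE x b :
  hom_map_fun x (lproj (boundaries f g x) b) =
  lproj (boundaries f' g' x) (sub_map (@cycles_map x) b).
Proof. exact: quot_mapE. Qed.
Fact hom_map_nat x y (h : (x <= y)%O) m :
  hom_map_fun y (pm_tr (homology f g) h m) = pm_tr (homology f' g') h (hom_map_fun x m).
Proof.
rewrite -[m]lprojK [RHS](congr1 (pm_tr (homology f' g') h) (hom_map_funE _)).
rewrite [LHS](congr1 (hom_map_fun y) (hom_trE f h _)) [LHS]hom_map_funE.
rewrite [RHS](hom_trE f' h); congr lproj.
by apply: val_inj; rewrite /= pm_nat.
Qed.
Definition hom_map : pmor (homology f g) (homology f' g') := PMor hom_map_nat.
End Map.

End HomologyIsomorphism.

Section HomologyTheory.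
Variables (k : fieldType) (d : Order.disp_t) (T : porderType d).

(** Inverse isomorphisms of homology only need u and v to respect cycles and
    boundaries in one degree, and to be mutually inverse on cycles up to
    boundaries. *)
Lemma homology_iso (A B C A' B' C' : pmod k T) (f : pmor A B) (g : pmor B C)
    (f' : pmor A' B') (g' : pmor B' C') (u : pmor B B') (v : pmor B' B) :
  (forall x b, g x b = 0 -> g' x (u x b) = 0) ->
  (forall x a, exists a', f' x a' = u x (f x a)) ->
  (forall x b, g' x b = 0 -> g x (v x b) = 0) ->
  (forall x a, exists a', f x a' = v x (f' x a)) ->
  (forall x b, g x b = 0 -> exists a, f x a = v x (u x b) - b) ->
  (forall x b, g' x b = 0 -> exists a, f' x a = u x (v x b) - b) ->
  pm_iso (homology f g) (homology f' g').
Proof.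
move=> uc ub vc vb vu uv; exists (hom_map uc ub), (hom_map vc vb) => x; split=> b;
    rewrite -[b]lprojK.
- rewrite [LHS](congr1 (hom_map_fun vc vb x) (hom_map_funE _ _ _)) [LHS]hom_map_funE.
  apply/lproj_eqP; rewrite /= /im_set /=; apply: vu; exact/asboolP/(valP (repr b)).
- rewrite [LHS](congr1 (hom_map_fun uc ub x) (hom_map_funE _ _ _)) [LHS]hom_map_funE.
  apply/lproj_eqP; rewrite /= /im_set /=; apply: uv; exact/asboolP/(valP (repr b)).
Qed.

Lemma homology_zero (A B C : pmod k T) (f : pmor A B) (g : pmor B C) :
  (forall x b, g x b = 0 -> exists a, f x a = b) -> pm_zero (homology f g).
Proof.
move=> fg x b; rewrite -[b]lprojK; apply/lproj_eq0.
by apply: fg; exact/asboolP/(valP (repr b)).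
Qed.
End HomologyTheory.

Section TensorFunctor.
Variables (k : fieldType) (d : Order.disp_t) (T : porderType d) (l : T -> T -> T).
Variable N : pmod k T.
Local Notation "f %:tens" := (tensor_map l f (pm_fid N)) (at level 1).

Lemma tensor_map_comp (A B C : pmod k T) (g : pmor B C) (f : pmor A B) x u :
  (pm_compose g f)%:tens x u = g%:tens x (f%:tens x u).
Proof.
move: u; apply: (tensor_ext (g := g%:tens x \o f%:tens x)) => ab i m n.
by rewrite [RHS](congr1 (g%:tens x) (tensor_mapE _ _ _ _ _)) !tensor_mapE.
Qed.

Lemma tensor_map_id (A : pmod k T) x u : (pm_fid A)%:tens x u = u.
Proof. by move: u; apply: (tensor_ext (g := idfun)) => ab i m n; rewrite tensor_mapE. Qed.

Lemma tensor_map_lin (A B : pmod k T) c (f g : pmor A B) x u :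
  (pm_lincomb c f g)%:tens x u = c *: f%:tens x u + g%:tens x u.
Proof.
move: u; apply: (tensor_ext (g := pm_lincomb c f%:tens g%:tens x)) => ab i m n.
by rewrite tensor_mapE [RHS]pm_lincombE !tensor_mapE pm_lincombE pure_tensorPl.
Qed.

Lemma tensor_map_eq (A B : pmod k T) (f g : pmor A B) x u :
  (forall x m, f x m = g x m) -> f%:tens x u = g%:tens x u.
Proof. by move=> fg; move: u; apply: tensor_ext => ab i m n; rewrite !tensor_mapE fg. Qed.

Lemma tensor_chain_map (M : pmod k T) (P Q : projective_resolution M)
    (f : forall n, pmor (P n) (Q n))
    n x u : chain_map f ->
  (res_d Q n)%:tens x ((f n.+1)%:tens x u) = (f n)%:tens x ((res_d P n)%:tens x u).
Proof. by move=> fC; rewrite -!tensor_map_comp; apply: tensor_map_eq => y m; apply: fC. Qed.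

Lemma chain_map_comp (M1 M2 M3 : pmod k T) (P : projective_resolution M1)
    (Q : projective_resolution M2) (Q' : projective_resolution M3)
    (f : forall n, pmor (P n) (Q n)) (g : forall n, pmor (Q n) (Q' n)) :
  chain_map f -> chain_map g -> chain_map (fun n => pm_compose (g n) (f n)).
Proof. by move=> fC gC n x p; rewrite /= gC fC. Qed.

(** If h is a homotopy from the composite to the identity, then on a cycle b the
    difference is d (h b) + h (d b), whose second term vanishes. *)
Lemma tensor_homotopy (M : pmod k T) (P Q : projective_resolution M)
    (f : forall n, pmor (P n) (Q n))
    (g : forall n, pmor (Q n) (P n)) n x b :
  chain_map f -> chain_map g ->
  (forall x p, res_aug Q x (f 0%N x p) = res_aug P x p) ->
  (forall x p, res_aug P x (g 0%N x p) = res_aug Q x p) ->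
  (res_d P n)%:tens x b = 0 ->
  exists a, (res_d P n.+1)%:tens x a = (g n.+1)%:tens x ((f n.+1)%:tens x b) - b.
Proof.
move=> fC gC f0 g0 b0.
have [||h hP] := @lift_homotopy _ _ _ _ _ P P _ (fun n => pm_fid (P n))
    (chain_map_comp fC gC).
- by [].
- by move=> y p; rewrite /= g0 f0.
pose h' := pm_compose (h n) (res_d P n).
pose dh := pm_compose (res_d P n.+1) (h n.+1).
exists ((h n.+1)%:tens x b); apply/eqP; rewrite eq_sym subr_eq; apply/eqP.
rewrite -!tensor_map_comp.
rewrite (tensor_map_eq (g := pm_lincomb 1 (pm_lincomb 1 dh h') (pm_fid _))); last first.
  by move=> y m; rewrite hP /= !scale1r.
have h'0 : h'%:tens x b = 0 by rewrite [LHS]tensor_map_comp b0 raddf0.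
rewrite [LHS]tensor_map_lin [LHS](congr2 +%R (scale1r _) (tensor_map_id _)).
congr (_ + b); rewrite [LHS]tensor_map_lin.
by rewrite [LHS](congr2 +%R (scale1r _) h'0) addr0.
Qed.

(** Tor may be computed from any projective resolution: lift the identity of M
    both ways; the two composites are homotopic to the identity, and the
    homotopies survive tensoring with N. *)
Lemma Tor_resolution (M : pmod k T) (Q : projective_resolution M) j :
  pm_iso (Tor l j.+1 M N) (homology (res_d Q j.+1)%:tens (res_d Q j)%:tens).
Proof.
rewrite /Tor; set P := chosen_resolution M.
have [f [fC f0]] := lift_chain_map P Q; have [g [gC g0]] := lift_chain_map Q P.
apply: (homology_iso (u := (f j.+1)%:tens) (v := (g j.+1)%:tens)) => x b.
- by move=> b0; rewrite tensor_chain_map // b0 raddf0.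
- by exists ((f j.+2)%:tens x b); rewrite tensor_chain_map.
- by move=> b0; rewrite tensor_chain_map // b0 raddf0.
- by exists ((g j.+2)%:tens x b); rewrite tensor_chain_map.
- exact: tensor_homotopy.
- exact: tensor_homotopy.
Qed.
End TensorFunctor.

(** * Interval modules *)

Lemma mklinE (k : fieldType) (V W : lmodType k) (f : V -> W) (fL : linear f) v :
  mklin fL v = f v.
Proof. by []. Qed.

Section IntervalModules.
Variables (k : fieldType) (d : Order.disp_t) (T : porderType d).

Section Coordinates.
Variable A : interval T.

Fact itv_coord_linear x :
  linear (fun v : itv_mod k A x => \sum_i (v : 'rV_(x \in A)) 0 i : k^o).
Proof.
move=> c u v; rewrite scaler_sumr -big_split; apply: eq_bigr => i _.
by rewrite !mxE.
Qed.
(** On A this is the isomorphism with the field, off A it is zero; together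
    with the constant section itv_gen below it replaces case analysis on the
    dimension of the fibres. *)
Definition itv_coord x : {linear itv_mod k A x -> k^o} := mklin (@itv_coord_linear x).

Definition itv_gen x : itv_mod k A x := const_mx 1 : 'rV_(x \in A).

Lemma itv_coordK x (v : itv_mod k A x) : v = itv_coord x v *: itv_gen x.
Proof.
have aux (b : bool) (w : 'rV[k]_b) : w = (\sum_i w 0 i) *: const_mx 1.
  case: b w => w; apply/rowP => i; last by case: i.
  by rewrite !mxE big_ord_recl big_ord0 addr0 mulr1; congr (w _ _); rewrite [LHS]ord1.
exact: aux.
Qed.

Lemma itv_out x (v : itv_mod k A x) : x \notin A -> v = 0.
Proof.
have aux (b : bool) (w : 'rV[k]_b) : ~~ b -> w = 0.
  by case: b w => // w _; apply/rowP => -[].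
exact: aux.
Qed.

Lemma itv_coord_gen x : x \in A -> itv_coord x (itv_gen x) = 1.
Proof.
have aux (b : bool) : b -> \sum_i (const_mx 1 : 'rV[k]_b) 0 i = 1.
  by case: b => // _; rewrite big_ord_recl big_ord0 addr0 mxE.
exact: aux.
Qed.

Lemma itv_gen_tr x y (h : (x <= y)%O) : x \in A ->
  pm_tr (itv_mod k A) h (itv_gen x) = itv_gen y.
Proof.
have aux (b c : bool) : b ->
    (const_mx 1 : 'rV[k]_b) *m (const_mx 1 : 'M_(b, c)) = const_mx 1.
  case: b => // _; apply/rowP => i.
  by rewrite !mxE big_ord_recl big_ord0 !mxE mulr1 addr0.
exact: aux.
Qed.

Lemma itv_coord_tr x y (h : (x <= y)%O) v : x \in A -> y \in A ->
  itv_coord y (pm_tr (itv_mod k A) h v) = itv_coord x v.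
Proof.
move=> xA yA; rewrite [in LHS](itv_coordK v) !linearZ_LR itv_gen_tr //.
by rewrite itv_coord_gen // [LHS]mulr1.
Qed.
End Coordinates.

Section IntervalMorphism.
Variables A B : interval T.
Hypothesis AB : forall x y, (x <= y)%O -> x \in A -> y \in B -> (y \in A) = (x \in B).

Fact itv_mor_linear x :
  linear (fun v : itv_mod k A x => itv_coord A x v *: itv_gen B x).
Proof. by move=> c u v; rewrite [itv_coord _ _ _]linearP scalerDl scalerA. Qed.
Fact itv_mor_nat x y (h : (x <= y)%O) (v : itv_mod k A x) :
  mklin (@itv_mor_linear y) (pm_tr (itv_mod k A) h v) =
  pm_tr (itv_mod k B) h (mklin (@itv_mor_linear x) v).
Proof.
have [xA|xA] := boolP (x \in A); last by rewrite (itv_out v xA) !raddf0.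
have [yB|yB] := boolP (y \in B); last by rewrite [LHS](itv_out _ yB) [RHS](itv_out _ yB).
rewrite [LHS]mklinE [X in _ = pm_tr _ _ X]mklinE [RHS]linearZ_LR.
have [xB|xB] := boolP (x \in B).
  by rewrite itv_gen_tr // itv_coord_tr // (AB h xA yB).
rewrite [itv_gen B x](itv_out _ xB) raddf0 scaler0.
by rewrite [pm_tr _ _ v]itv_out ?(AB h xA yB) // raddf0 scale0r.
Qed.
(** The condition AB asks that the squares commute: whenever both ends of a
    transition carry a generator, the two intermediate fibres vanish
    together. *)
Definition itv_mor : pmor (itv_mod k A) (itv_mod k B) := PMor itv_mor_nat.

Lemma itv_mor_gen x : x \in A -> itv_mor x (itv_gen A x) = itv_gen B x.
Proof. by move=> xA; rewrite [LHS]mklinE itv_coord_gen // scale1r. Qed.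
End IntervalMorphism.

(** Transition maps extended by zero to incomparable points, so that families
    indexed by all points can be written without a proof of comparability. *)
Definition total_tr (M : pmod k T) x y : {linear M x -> M y} :=
  match pselect (x <= y)%O with
  | left h => pm_tr M h
  | right _ => mklin (@zero_linear k _ _)
  end.

Lemma total_trE (M : pmod k T) x y (h : (x <= y)%O) m : total_tr M x y m = pm_tr M h m.
Proof.
rewrite /total_tr; case: pselect => [h'|/(_ h)//].
by congr (pm_tr M _ m); apply: bool_irrelevance.
Qed.

Lemma total_tr_tr (M : pmod k T) x y z (h : (x <= y)%O) m : (y <= z)%O ->
  total_tr M y z (pm_tr M h m) = total_tr M x z m.
Proof. by move=> yz; rewrite !total_trE ?(le_trans h) // => ?; rewrite -[LHS](pm_comp _ _ _ _). Qed.

Lemma total_tr_id (M : pmod k T) x m : total_tr M x x m = m.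
Proof. by rewrite total_trE pm_id. Qed.

Section Representable.
Variable a : T.
Notation rep := (itv_mod k `[a, +oo[).

Section Morphism.
Variables (M : pmod k T) (m : M a).
Fact rep_mor_linear x :
  linear (fun v : rep x => itv_coord _ x v *: total_tr M a x m).
Proof. by move=> c u v; rewrite [itv_coord _ _ _]linearP scalerDl scalerA. Qed.
Fact rep_mor_nat x y (h : (x <= y)%O) (v : rep x) :
  mklin (@rep_mor_linear y) (pm_tr rep h v) =
  pm_tr M h (mklin (@rep_mor_linear x) v).
Proof.
have [xa|xa] := boolP (x \in `[a, +oo[); last by rewrite (itv_out v xa) !raddf0.
have ax : (a <= x)%O by move: xa; rewrite in_itv andbT.
have ya : y \in `[a, +oo[ by rewrite in_itv /= andbT (le_trans ax).
rewrite [LHS]mklinE [X in _ = pm_tr _ _ X]mklinE [RHS]linearZ_LR.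
rewrite [itv_coord _ _ _]itv_coord_tr //.
congr (_ *: _); rewrite (total_trE ax) (total_trE (le_trans ax h)).
exact: pm_comp.
Qed.
Definition rep_mor : pmor rep M := PMor rep_mor_nat.
End Morphism.

(** Yoneda: a morphism out of k[a, oo) is determined by the image of the
    generator at a, which may be any vector there. *)
Lemma rep_projective : pm_projective rep.
Proof.
move=> A B e e_epi f; have [m em] := e_epi a (f a (itv_gen _ a)).
exists (rep_mor m) => x p.
have [xa|xa] := boolP (x \in `[a, +oo[); last by rewrite (itv_out p xa) !raddf0.
have ax : (a <= x)%O by move: xa; rewrite in_itv andbT.
rewrite [X in e x X]mklinE [LHS]linearZ_LR (total_trE ax) pm_nat em -pm_nat.
rewrite itv_gen_tr; last by rewrite in_itv /= lexx.
by rewrite -[LHS]linearZ_LR -itv_coordK.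
Qed.
End Representable.

Lemma bijective_iso (M N : pmod k T) (g : pmor M N) :
  (forall x m, g x m = 0 -> m = 0) -> (forall x n, exists m, g x m = n) ->
  pm_iso N M.
Proof.
move=> g_inj g_surj; pose f x n := sval (cid (g_surj x n)).
have gf x n : g x (f x n) = n by rewrite /f; case: cid.
have gI x u v : g x u = g x v -> u = v.
  move=> guv; apply/eqP; rewrite -subr_eq0; apply/eqP/g_inj.
  by rewrite linearB guv subrr.
have fL x : linear (f x).
  by move=> c u v; apply: (@gI x); rewrite linearP !gf.
have f_nat x y (h : (x <= y)%O) n : mklin (@fL y) (pm_tr N h n) = pm_tr M h (mklin (@fL x) n).
  by apply: (@gI y); rewrite pm_nat /= !gf.
exists (PMor f_nat), g => x; split=> n; first exact: gf.
by apply: (@gI x); rewrite gf.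
Qed.

(** An interval module is recognized by a section e that is carried along by
    the transition maps and spans every fibre. *)
Lemma interval_iso (H : pmod k T) (A : interval T) (e : forall x, H x) :
  (forall x y (h : (x <= y)%O), x \in A -> y \in A -> pm_tr H h (e x) = e y) ->
  (forall x u, x \in A -> exists c, u = c *: e x) ->
  (forall x, x \in A -> e x <> 0) ->
  (forall x (u : H x), x \notin A -> u = 0) ->
  pm_iso H (itv_mod k A).
Proof.
move=> e_tr e_gen e_nz H_out.
have gL x : linear (fun v : itv_mod k A x => itv_coord A x v *: e x).
  by move=> c u v; rewrite [itv_coord _ _ _]linearP scalerDl scalerA.
have g_nat x y (h : (x <= y)%O) (v : itv_mod k A x) :
    mklin (@gL y) (pm_tr (itv_mod k A) h v) = pm_tr H h (mklin (@gL x) v).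
  have [xA|xA] := boolP (x \in A); last by rewrite (itv_out v xA) !raddf0.
  have [yA|yA] := boolP (y \in A); last by rewrite [LHS]H_out // [RHS]H_out.
  rewrite [LHS]mklinE [X in _ = pm_tr _ _ X]mklinE [RHS]linearZ_LR e_tr //.
  by rewrite [itv_coord _ _ _]itv_coord_tr.
apply: (@bijective_iso _ _ (PMor g_nat)) => x v.
  have [xA|xA] := boolP (x \in A); last by rewrite (itv_out v xA).
  rewrite [LHS]mklinE => /eqP; rewrite scaler_eq0 => /orP[/eqP v0|/eqP/e_nz//].
  by rewrite (itv_coordK v) [itv_coord _ _ v]v0 scale0r.
have [xA|xA] := boolP (x \in A); last by exists 0; rewrite [LHS]H_out // [RHS]H_out.
have [c ->] := e_gen x v xA; exists (c *: itv_gen A x).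
by rewrite [LHS]mklinE [itv_coord _ _ _]linearZ_LR itv_coord_gen // [c *: 1]mulr1.
Qed.
End IntervalModules.

(** * Two-term resolutions *)

Section TwoTerm.
Variables (k : fieldType) (d : Order.disp_t) (T : porderType d).

Definition zero_pmod : pmod k T := @PMod k d T (fun _ => 'rV[k]_0) (fun _ _ _ => idfun)
  (fun _ _ _ => erefl) (fun _ _ _ _ _ _ _ => erefl).

Lemma zero_pmodE : pm_zero zero_pmod.
Proof. by move=> x m; apply/rowP => -[]. Qed.

Lemma pm_zero_projective (P : pmod k T) : pm_zero P -> pm_projective P.
Proof.
move=> P0 A B e _ f; exists (pm_fzero P A) => x p.
by rewrite [p]P0 !raddf0.
Qed.

Lemma tensor_zero l (M N : pmod k T) : pm_zero M -> pm_zero (tensor l M N).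
Proof.
move=> M0 x u.
have eq0P c (v w : tensor l M N x) : v = 0 -> w = 0 -> c *: v + w = 0.
  by move=> -> ->; rewrite scaler0 addr0.
apply: (tensor_spanned (W := Subspace (erefl : 0 = 0 :> tensor l M N x) eq0P)).
by move=> ab i m n; rewrite [m]M0; apply: pure_tensor0l.
Qed.

Lemma pm_zero_iso (M N : pmod k T) : pm_iso M N -> pm_zero N -> pm_zero M.
Proof.
by move=> [f [g fg]] N0 x m; rewrite -[m](fg x).1 [f x m]N0 raddf0.
Qed.

Lemma pm_iso_trans (L M N : pmod k T) : pm_iso L M -> pm_iso M N -> pm_iso L N.
Proof.
move=> [f [g fg]] [f' [g' fg']].
exists (pm_compose f' f), (pm_compose g g') => x; split=> u /=.
  by rewrite (fg' x).1 (fg x).1.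
by rewrite (fg x).2 (fg' x).2.
Qed.

Variables (P1 P0 M : pmod k T) (i : pmor P1 P0) (e : pmor P0 M).
Hypotheses (P1proj : pm_projective P1) (P0proj : pm_projective P0).
Hypotheses (e_epi : pm_epi e) (ie : pm_exact i e).
Hypothesis i_inj : forall x p, i x p = 0 -> p = 0.

Definition two_term_obj n : pmod k T :=
  match n with 0 => P0 | 1 => P1 | _ => zero_pmod end.
Definition two_term_d n : pmor (two_term_obj n.+1) (two_term_obj n) :=
  match n with 0 => i | m.+1 => pm_fzero zero_pmod (two_term_obj m.+1) end.

Definition two_term_resolution : projective_resolution M.
Proof.
apply: (@ProjectiveResolution k d T M two_term_obj two_term_d e) => //.
- by move=> [|[|n]] //; apply: pm_zero_projective zero_pmodE.
- move=> [|n] x b; split.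
  + by move=> /i_inj ->; exists 0.
  + by move=> [a <-]; exact: (raddf0 (i x)).
  + by move=> _; exists 0; rewrite [RHS](zero_pmodE b).
  + by move=> [a <-]; case: n a b.
Defined.

Variables (l : T -> T -> T) (N : pmod k T).

(** Above degree one the resolution is zero, and so is its tensor product. *)
Lemma Tor_ge2_two_term j : (2 <= j)%N -> pm_zero (Tor l j M N).
Proof.
case: j => [|[|j]] // _; apply: pm_zero_iso (Tor_resolution l N two_term_resolution _) _.
by apply: homology_zero => x b _; exists 0; rewrite raddf0 [b]tensor_zero //; apply: zero_pmodE.
Qed.

Lemma Tor1_two_term :
  pm_iso (Tor l 1 M N) (homology
    (tensor_map l (pm_fzero zero_pmod P1) (pm_fid N)) (tensor_map l i (pm_fid N))).
Proof. exact: Tor_resolution two_term_resolution _. Qed.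
End TwoTerm.

(** * Tensor products and Tor of intervals *)

Section HomologyClasses.
Variables (k : fieldType) (d : Order.disp_t) (T : porderType d).
Variables (A B C : pmod k T) (f : pmor A B) (g : pmor B C).

(** Extended by zero to all of B, because the sections to which it is applied
    are cycles only at some of the points. *)
Definition hom_class x (b : B x) : homology f g x :=
  match pselect (b \in subspace_pred (cycles g x)) with
  | left h => lproj (boundaries f g x) (exist _ b h)
  | right _ => 0
  end.

Lemma hom_classE x b (h : b \in subspace_pred (cycles g x)) :
  hom_class b = lproj (boundaries f g x) (exist _ b h).
Proof.
rewrite /hom_class; case: pselect => [h'|/(_ h)//].
by congr lproj; apply: val_inj.
Qed.

Lemma hom_class_surj x (u : homology f g x) : exists2 b, g x b = 0 & u = hom_class b.
Proof.
rewrite -[u]lprojK; case: (repr u) => b h; exists b; first exact/asboolP.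
by rewrite hom_classE.
Qed.

Lemma hom_class_eq0 x b : g x b = 0 -> hom_class b = 0 :> homology f g x ->
  exists a, f x a = b.
Proof.
by move=> /asboolP gb; rewrite (hom_classE (gb : b \in subspace_pred (cycles g x))) => /lproj_eq0.
Qed.

Lemma hom_classZ x c b : g x b = 0 -> hom_class (c *: b) = c *: hom_class b.
Proof.
move=> gb; have h : b \in subspace_pred (cycles g x) by exact/asboolP.
have hc : c *: b \in subspace_pred (cycles g x).
  by apply/asboolP; rewrite /= linearZ_LR gb scaler0.
rewrite (hom_classE hc) (hom_classE h) -[RHS]linearZ_LR; congr lproj.
exact: val_inj.
Qed.

Lemma hom_class_tr x y (h : (x <= y)%O) b : g x b = 0 ->
  pm_tr (homology f g) h (hom_class b) = hom_class (pm_tr B h b).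
Proof.
move=> gb; have bC : b \in subspace_pred (cycles g x) by exact/asboolP.
have trC : pm_tr B h b \in subspace_pred (cycles g y) by exact/asboolP/cycles_tr.
rewrite (hom_classE bC) (hom_classE trC) [LHS]hom_trE; congr lproj.
exact: val_inj.
Qed.
End HomologyClasses.

Section IntervalTensor.
Variables (k : fieldType) (d : Order.disp_t) (T : orderType d) (l : T -> T -> T).
Hypothesis l_mono : forall s s' t t', (s <= s' -> t <= t' -> l s t <= l s' t')%O.
Variables (c e : T).
Hypothesis ce : (c < e)%O.
Local Notation N := (itv_mod k `[c, e[).
Local Notation rep a := (itv_mod k `[a, +oo[).

Lemma rep_in (a x : T) : (x \in `[a, +oo[) = (a <= x)%O.
Proof. by rewrite in_itv andbT. Qed.

Lemma ce_in : c \in `[c, e[.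
Proof. by rewrite in_itv /= lexx. Qed.

(** The tensor product of the two generators. The submodule it spans is all of
    k[a, oo) tensored with k[c, e), see pair_gen_span; it lives exactly between
    l a c and l a e. *)
Definition pair_gen (a x : T) : tensor l (rep a) N x :=
  match pselect (below l x (a, c)) with
  | left h => pure_tensor h (itv_gen k `[a, +oo[ a) (itv_gen k `[c, e[ c)
  | right _ => 0
  end.

Lemma pair_genE a x (h : below l x (a, c)) :
  pair_gen a x = pure_tensor h (itv_gen k `[a, +oo[ a) (itv_gen k `[c, e[ c).
Proof.
rewrite /pair_gen; case: pselect => [h'|/(_ h)//].
by rewrite (bool_irrelevance h h').
Qed.

Lemma pair_gen_out a x : ~~ (l a c <= x)%O -> pair_gen a x = 0.
Proof. by rewrite /pair_gen; case: pselect => // h; rewrite [(_ <= _)%O]h. Qed.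

(** Every product of generators is transported from the position (a, c). *)
Lemma pure_tensor_pair_gen a x ab (i : below l x ab) :
  (a <= ab.1)%O -> (c <= ab.2)%O ->
  pure_tensor i (itv_gen k `[a, +oo[ ab.1) (itv_gen k `[c, e[ ab.2) = pair_gen a x.
Proof.
move=> a1 c2; have h : below l x (a, c) by apply: le_trans i; apply: l_mono.
rewrite (pair_genE h) -(pure_tensor_le h i a1 c2) itv_gen_tr ?itv_gen_tr ?ce_in //.
by rewrite rep_in.
Qed.

Lemma pair_gen_tr a x y (h : (x <= y)%O) : (l a c <= x)%O ->
  pm_tr (tensor l (rep a) N) h (pair_gen a x) = pair_gen a y.
Proof.
move=> lx; have i : below l x (a, c) by [].
by rewrite (pair_genE i) [LHS]pure_tensor_tr (pure_tensor_pair_gen (ab := (a, c))).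
Qed.

Lemma pair_gen_span a x (u : tensor l (rep a) N x) : exists r, u = r *: pair_gen a x.
Proof.
have W0 : exists r, 0 = r *: pair_gen a x by exists 0; rewrite scale0r.
have WP r v w : (exists s, v = s *: pair_gen a x) -> (exists s, w = s *: pair_gen a x) ->
    exists s, r *: v + w = s *: pair_gen a x.
  by move=> [s ->] [s' ->]; exists (r * s + s'); rewrite scalerDl scalerA.
apply: (tensor_spanned (W := Subspace W0 WP)) => ab i m n /=.
have [a1|a1] := boolP (ab.1 \in `[a, +oo[); last first.
  by rewrite (itv_out m a1) pure_tensor0l.
have [c2|c2] := boolP (ab.2 \in `[c, e[); last first.
  by rewrite (itv_out n c2) pure_tensor0r.
rewrite (itv_coordK m) (itv_coordK n) pure_tensorZl pure_tensorZr scalerA pure_tensor_pair_gen.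
- by exists (itv_coord k `[a, +oo[ ab.1 m * itv_coord k `[c, e[ ab.2 n).
- by rewrite rep_in in a1.
- by move: c2; rewrite in_itv => /andP[].
Qed.

(** Once the position (a, e) is available, the second factor dies there. *)
Lemma pair_gen_large a x : (l a e <= x)%O -> pair_gen a x = 0.
Proof.
move=> lx; have i : below l x (a, e) by [].
rewrite -(pure_tensor_pair_gen (ab := (a, e)) i) //; last exact: ltW.
by rewrite [itv_gen k `[c, e[ e]itv_out ?pure_tensor0r // in_itv /= ltxx andbF.
Qed.

(** The product of the two coordinates detects the generator. It is compatible
    with the transition maps because no position (s, t) with a <= s and e <= t
    is available as long as x < l a e. *)
Lemma pair_gen_neq0 a x : (l a c <= x)%O -> (x < l a e)%O -> pair_gen a x <> 0.
Proof.
move=> lx xl; have i : below l x (a, c) by [].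
pose b (ab : (T *p T)%type) (m : rep a ab.1) (n : N ab.2) : k^o :=
  itv_coord _ _ _ m * itv_coord _ _ _ n.
have bl (ab : (T *p T)%type) r (m m' : rep a ab.1) (n : N ab.2) :
    b ab (r *: m + m') n = r *: b ab m n + b ab m' n.
  by rewrite /b [itv_coord _ _ _ (_ + _)]linearP mulrDl scalerAl.
have br (ab : (T *p T)%type) r (m : rep a ab.1) (n n' : N ab.2) :
    b ab m (r *: n + n') = r *: b ab m n + b ab m n'.
  by rewrite /b [itv_coord _ _ _ (_ + _)]linearP mulrDr scalerAr.
have b_tr (ab ab' : (T *p T)%type) (i1 : below l x ab) (i2 : below l x ab')
    (h1 : (ab.1 <= ab'.1)%O) (h2 : (ab.2 <= ab'.2)%O) m n :
    b ab' (pm_tr (rep a) h1 m) (pm_tr N h2 n) = b ab m n.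
  rewrite /b.
  have [a1|a1] := boolP (ab.1 \in `[a, +oo[); last first.
    by rewrite (itv_out m a1) !raddf0 !mul0r.
  have [c2|c2] := boolP (ab.2 \in `[c, e[); last first.
    by rewrite (itv_out n c2) !raddf0 !mulr0.
  have a1' : ab'.1 \in `[a, +oo[.
    by move: a1; rewrite !rep_in => /le_trans; apply.
  have c2' : ab'.2 \in `[c, e[.
    move: c2; rewrite !in_itv /= => /andP[c2 _]; rewrite (le_trans c2) //=.
    rewrite ltNge; apply: contraL xl => e2; rewrite -leNgt; apply: le_trans i2.
    by apply: l_mono => //; rewrite -rep_in.
  by rewrite !itv_coord_tr.
move=> g0; have := tensor_liftE bl br b_tr i (itv_gen _ _ _) (itv_gen _ _ _).
rewrite -pair_genE g0 raddf0 /b !itv_coord_gen ?ce_in ?rep_in // mulr1.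
by move=> /esym/eqP; rewrite oner_eq0.
Qed.

Fact rep_mono (a b : T) : (a <= b)%O -> forall x y, (x <= y)%O -> x \in `[b, +oo[ ->
  y \in `[a, +oo[ -> (y \in `[b, +oo[) = (x \in `[a, +oo[).
Proof.
move=> ab x y xy; rewrite !rep_in => bx ay.
by rewrite (le_trans bx xy) (le_trans ab bx).
Qed.

Lemma pair_gen_map (a b : T) (ab : (a <= b)%O) x : (l b c <= x)%O ->
  tensor_map l (itv_mor k (rep_mono ab)) (pm_fid N) x (pair_gen b x) = pair_gen a x.
Proof.
move=> lx; have i : below l x (b, c) by [].
rewrite (pair_genE i) [LHS]tensor_mapE itv_mor_gen ?rep_in //.
by rewrite [pm_fid _ _ _]/= (pure_tensor_pair_gen (ab := (b, c))).
Qed.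

Section Tor.
Variables (a b : T).
Hypothesis ab : (a < b)%O.

Fact rep_itv_mor x y : (x <= y)%O -> x \in `[a, +oo[ ->
  y \in `[a, b[ -> (y \in `[a, +oo[) = (x \in `[a, b[).
Proof.
move=> xy; rewrite !rep_in !in_itv /= => ax /andP[ay yb].
by rewrite ax ay (le_lt_trans xy yb).
Qed.

Let incl := itv_mor k (rep_mono (ltW ab)).
Let proj := itv_mor k rep_itv_mor.

Fact itv_proj_epi : pm_epi proj.
Proof.
move=> x n; have [xab|xab] := boolP (x \in `[a, b[); last first.
  by exists 0; rewrite [RHS](itv_out n xab) raddf0.
exists (itv_coord _ _ _ n *: itv_gen _ _ _).
rewrite [LHS]linearZ_LR itv_mor_gen -?itv_coordK // rep_in.
by move: xab; rewrite in_itv => /andP[].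
Qed.

Fact itv_incl_inj x p : incl x p = 0 -> p = 0.
Proof.
have [xb|xb] := boolP (x \in `[b, +oo[); last by rewrite (itv_out p xb).
have xa : x \in `[a, +oo[ by move: xb; rewrite !rep_in; apply/le_trans/ltW.
rewrite (itv_coordK p) [incl _ _]linearZ_LR itv_mor_gen // => p0.
have := congr1 (itv_coord k _ x) p0.
by rewrite linearZ_LR raddf0 itv_coord_gen // [_ *: _]mulr1 => ->; rewrite scale0r.
Qed.

(** In k[b, oo) -> k[a, oo) -> k[a, b) everything vanishes before a, the last
    two terms agree on [a, b), and the first two agree from b on. *)
Fact itv_incl_exact : pm_exact incl proj.
Proof.
move=> x v; have [xa|xa] := boolP (x \in `[a, +oo[); last first.
  rewrite (itv_out v xa); split=> _; [exists 0|]; exact: raddf0.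
have [xb|xb] := boolP (x \in `[b, +oo[).
  split=> _.
    exists (itv_coord _ _ _ v *: itv_gen _ _ _).
    by rewrite [LHS]linearZ_LR itv_mor_gen // -itv_coordK.
  apply: itv_out; rewrite in_itv /= negb_and -leNgt.
  by move: xb; rewrite rep_in => ->; rewrite orbT.
have xab : x \in `[a, b[.
  by move: xa xb; rewrite !rep_in in_itv /= -ltNge => -> ->.
rewrite (itv_coordK v) [proj _ _]linearZ_LR itv_mor_gen //; split.
  move=> /(congr1 (itv_coord k _ x)).
  rewrite linearZ_LR raddf0 itv_coord_gen // [_ *: _]mulr1 => ->.
  by exists 0; rewrite raddf0 scale0r.
move=> [p]; rewrite (itv_out p xb) raddf0 => /(congr1 (itv_coord k _ x)).
by rewrite linearZ_LR raddf0 itv_coord_gen // [_ *: _]mulr1 => <-; rewrite scale0r.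
Qed.

(** By pair_gen_map the tensored inclusion maps the generator over b to the
    generator over a. So its kernel is spanned by the former where it is alive,
    from l b c up to l b e, and where the latter is already dead, from l a e
    on. *)
Lemma Tor1_interval :
  pm_iso (homology (tensor_map l (pm_fzero (zero_pmod k T) (rep b)) (pm_fid N))
                   (tensor_map l incl (pm_fid N)))
    (itv_mod k `[Order.max (l b c) (l a e), l b e[).
Proof.
set f := tensor_map l (pm_fzero _ _) _; set g := tensor_map l incl _.
set A := `[Order.max _ _, _[.
have AE x : (x \in A) = [&& (l b c <= x)%O, (l a e <= x)%O & (x < l b e)%O].
  by rewrite in_itv /= ge_max andbA.
have cyc x : x \in A -> g x (pair_gen b x) = 0.
  by rewrite AE => /and3P[bc ae _]; rewrite [LHS]pair_gen_map // pair_gen_large.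
apply: (interval_iso (e := fun x => hom_class f g (pair_gen b x))).
- move=> x y h xA yA; rewrite hom_class_tr ?cyc // pair_gen_tr //.
  by move: xA; rewrite AE => /andP[].
- move=> x u xA; have [v gv ->] := hom_class_surj u.
  by have [r ->] := pair_gen_span v; exists r; rewrite hom_classZ ?cyc.
- move=> x xA /(hom_class_eq0 (cyc x xA)) [v].
  rewrite [v]tensor_zero ?raddf0; last exact: zero_pmodE.
  by move: xA; rewrite AE => /and3P[bc _ be] /esym; apply: pair_gen_neq0.
- move=> x u; rewrite AE; have [v gv ->] := hom_class_surj u.
  have v0 w : w = 0 -> hom_class f g (x := x) w = 0.
    move=> ->; rewrite -[0](scale0r 0) hom_classZ ?raddf0 //; exact: scale0r.
  have [r vE] := pair_gen_span v.
  have [bc|bc] := boolP (l b c <= x)%O; last first.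
    by move=> _; apply: v0; rewrite vE pair_gen_out // scaler0.
  have [be|be] := leP (l b e) x.
    by move=> _; apply: v0; rewrite vE pair_gen_large // scaler0.
  rewrite andbT /= -ltNge => ae; apply: v0; rewrite vE.
  move: gv; rewrite vE linearZ_LR [g _ _]pair_gen_map // => /eqP.
  rewrite scaler_eq0 => /orP[/eqP->|/eqP]; first by rewrite scale0r.
  move=> g0; case: (pair_gen_neq0 _ ae g0).
  by apply: le_trans bc; apply: l_mono => //; apply: ltW.
Qed.

Lemma Tor_interval :
  pm_iso (Tor l 1 (itv_mod k `[a, b[) N)
    (itv_mod k `[Order.max (l b c) (l a e), l b e[)
  /\ forall i, (2 <= i)%N -> pm_zero (Tor l i (itv_mod k `[a, b[) N).
Proof.
have Pb : pm_projective (rep b) := @rep_projective _ _ _ _.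
have Pa : pm_projective (rep a) := @rep_projective _ _ _ _.
split; last first.
  move=> i i2; exact: (Tor_ge2_two_term Pb Pa itv_proj_epi itv_incl_exact itv_incl_inj i2).
apply: pm_iso_trans Tor1_interval.
exact: (Tor1_two_term Pb Pa itv_proj_epi itv_incl_exact itv_incl_inj).
Qed.
End Tor.
End IntervalTensor.

(** * Flat modules *)

Section Flatness.
Variables (k : fieldType) (d : Order.disp_t).

(** Tensoring with N preserves the exactness of any resolution. *)
Lemma Tor_flat (T : porderType d) l (M N : pmod k T) j :
  (forall (A B C : pmod k T) (f : pmor A B) (g : pmor B C),
    (forall x b, g x b = 0 -> exists a, f x a = b) ->
    forall x u, tensor_map l g (pm_fid N) x u = 0 ->
      exists v, tensor_map l f (pm_fid N) x v = u) ->
  (1 <= j)%N -> pm_zero (Tor l j M N).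
Proof.
case: j => // j flatN _; apply: homology_zero => x b; apply: flatN => y v.
by move=> /res_exact.
Qed.

Lemma tens_exact (A B C N : lmodType k) (f : {linear A -> B}) (g : {linear B -> C}) :
  (forall b, g b = 0 -> exists a, f a = b) ->
  forall u, tens_map g (idfun : {linear N -> N}) u = 0 ->
    exists v, tens_map f (idfun : {linear N -> N}) v = u.
Proof.
move=> /exact_split[s [t st]] u gu.
exists (tens_map t (idfun : {linear N -> N}) u).
pose sT := tens_map s (idfun : {linear N -> N}).
pose gT := tens_map g (idfun : {linear N -> N}).
pose fT := tens_map f (idfun : {linear N -> N}).
pose tT := tens_map t (idfun : {linear N -> N}).
have uL : linear (fun w => sT (gT w) + fT (tT w)).
  by move=> c v w; rewrite [gT _]linearP [sT _]linearP [tT _]linearP [fT _]linearP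
    scalerDr addrACA.
suff uE : u = sT (gT u) + fT (tT u) by rewrite [RHS]uE [gT u]gu raddf0 add0r.
move: u {gu}; apply: (presented_ext (f := idfun) (g := mklin uL)) => -[b n].
have tens_mapidE (V W : lmodType k) (h : {linear V -> W}) v :
    tens_map h (idfun : {linear N -> N}) (tensv v n) = tensv (h v) n.
  exact: tens_mapE.
rewrite [RHS]mklinE.
rewrite [RHS](congr2 +%R (congr1 sT (tens_mapidE _ _ _ _)) (congr1 fT (tens_mapidE _ _ _ _))).
rewrite [RHS](congr2 +%R (tens_mapidE _ _ _ _) (tens_mapidE _ _ _ _)) -[LHS]/(tensv b n).
by rewrite {1}(st b) -[s (g b)]scale1r tensvPl !scale1r.
Qed.

Section ColimGreatest.
Variables (d' : Order.disp_t) (J : porderType d') (F : pmod k J) (P : pred J) (j0 : J).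
Hypotheses (Pj0 : P j0) (j0_max : forall j, P j -> (j <= j0)%O).

Lemma colim_greatest_surj (u : colim F P) : exists v, u = colim_in Pj0 v.
Proof.
have W0 : exists v, 0 = colim_in (F := F) Pj0 v.
  by exists 0; rewrite [RHS](raddf0 (colim_inl F Pj0)).
have WP c u1 u2 : (exists v, u1 = colim_in (F := F) Pj0 v) ->
    (exists v, u2 = colim_in (F := F) Pj0 v) ->
    exists v, c *: u1 + u2 = colim_in (F := F) Pj0 v.
  move=> [v1 ->] [v2 ->]; exists (c *: v1 + v2).
  by rewrite [RHS](linearP (colim_inl F Pj0)).
apply: (colim_spanned (W := Subspace W0 WP)) => j h v /=.
by exists (pm_tr F (j0_max h) v); rewrite colim_in_tr.
Qed.

(** The transition maps to the greatest index form a cocone, and the map it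
    induces is a retraction. *)
Lemma colim_greatest_inj (v : F j0) : colim_in Pj0 v = 0 -> v = 0.
Proof.
have key i j (hi : P i) (hj : P j) (ij : (i <= j)%O) w :
    total_tr F j j0 (pm_tr F ij w) = total_tr F i j0 w.
  by rewrite total_tr_tr // j0_max.
move=> v0; have := colim_liftE key Pj0 v.
by rewrite v0 raddf0 total_tr_id.
Qed.
End ColimGreatest.

(** If l is the join, (x, x) is the greatest pair below x, so the tensor
    product at x is the tensor product over the field of the two fibres at x. *)
Lemma tensor_exact_join (T : porderType d) (l : T -> T -> T) (N : pmod k T) :
  (forall a b x, (l a b <= x)%O = (a <= x)%O && (b <= x)%O) ->
  forall (A B C : pmod k T) (f : pmor A B) (g : pmor B C),
    (forall x b, g x b = 0 -> exists a, f x a = b) ->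
    forall x u, tensor_map l g (pm_fid N) x u = 0 ->
      exists v, tensor_map l f (pm_fid N) x v = u.
Proof.
move=> lE A B C f g fg x u.
have i : below l x (x, x) by rewrite /below lE lexx.
have i_max ab : below l x ab -> (ab <= (x, x) :> (T *p T)%type)%O.
  by rewrite /below lE => /andP[h1 h2]; apply/andP.
have [v ->] := colim_greatest_surj (F := ext B N) (P := below l x) i i_max u.
rewrite [LHS]tensor_map_funE => /(colim_greatest_inj (F := ext C N) (P := below l x) i_max) gv.
have [w wv] := tens_exact (fg x) gv.
exists (colim_in (F := ext A N) i w); rewrite [LHS]tensor_map_funE.
by congr colim_in; exact: wv.
Qed.

Section RepFlat.
Variables (T : porderType d) (l : T -> T -> T) (a : T).
Hypothesis l_mono : forall s t t', (t <= t' -> l s t <= l s t')%O.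
Local Notation rep := (itv_mod k `[a, +oo[).

Section Point.
Variables (x m : T).
Hypothesis lm : forall s, (l s a <= x)%O = (s <= m)%O.

Fact rep_below : below l x (m, a). Proof. by rewrite /below lm. Qed.

(** If s <= m describes the s with l s a <= x, then B tensored with k[a, oo)
    has at x the fibre B m; this is the isomorphism. *)
Definition rep_ins (B : pmod k T) (v : B m) : tensor l B rep x :=
  pure_tensor (M := B) rep_below v (itv_gen k `[a, +oo[ a).

Lemma rep_ins_surj (B : pmod k T) u : exists v : B m, u = rep_ins v.
Proof.
have W0 : exists v : B m, 0 = rep_ins v by exists 0; rewrite /rep_ins pure_tensor0l.
have WP c u1 u2 : (exists v : B m, u1 = rep_ins v) -> (exists v : B m, u2 = rep_ins v) ->
    exists v : B m, c *: u1 + u2 = rep_ins v.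
  by move=> [v1 ->] [v2 ->]; exists (c *: v1 + v2); rewrite /rep_ins pure_tensorPl.
apply: (tensor_spanned (W := Subspace W0 WP)) => -[s t] i v n /=.
have [ta|ta] := boolP (t \in `[a, +oo[); last first.
  by exists 0; rewrite /rep_ins pure_tensor0l (itv_out n ta) pure_tensor0r.
have {ta} at_ : (a <= t)%O by move: ta; rewrite in_itv andbT.
have i' : below l x (s, a) by apply: le_trans i; apply: l_mono.
have sm : (s <= m)%O by rewrite -lm.
have aa : a \in `[a, +oo[ by rewrite in_itv /= lexx.
(* There need not be any comparison between (s, t) and (m, a): the element is
   first pulled back to (s, a) and then pushed forward. *)
exists (itv_coord k _ t n *: pm_tr B sm v).
rewrite /rep_ins pure_tensorZl (itv_coordK n) pure_tensorZr; congr (_ *: _).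
  by rewrite -itv_coordK.
rewrite -[v in LHS](pm_id (lexx s)) -(itv_gen_tr k at_ aa).
rewrite (pure_tensor_le (ab := (s, a)) i' i (lexx s) at_).
rewrite -[itv_gen _ _ a in RHS](pm_id (lexx a)).
by rewrite (pure_tensor_le (ab := (s, a)) (ab' := (m, a)) i' _ sm (lexx a)).
Qed.

Lemma rep_ins_inj (B : pmod k T) (v : B m) : rep_ins v = 0 -> v = 0.
Proof.
pose b (ab : (T *p T)%type) (w : B ab.1) (n : rep ab.2) : B m :=
  itv_coord _ _ _ n *: total_tr B ab.1 m w.
have bl (ab : (T *p T)%type) r (w w' : B ab.1) (n : rep ab.2) :
    b ab (r *: w + w') n = r *: b ab w n + b ab w' n.
  by rewrite /b [total_tr _ _ _ _]linearP scalerDr !scalerA mulrC.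
have br (ab : (T *p T)%type) r (w : B ab.1) (n n' : rep ab.2) :
    b ab w (r *: n + n') = r *: b ab w n + b ab w n'.
  by rewrite /b [itv_coord _ _ _ (_ + _)]linearP scalerDl scalerA.
have b_tr (ab ab' : (T *p T)%type) (i1 : below l x ab) (i2 : below l x ab')
    (h1 : (ab.1 <= ab'.1)%O) (h2 : (ab.2 <= ab'.2)%O) w n :
    b ab' (pm_tr B h1 w) (pm_tr rep h2 n) = b ab w n.
  rewrite /b; have [a2|a2] := boolP (ab.2 \in `[a, +oo[); last first.
    by rewrite (itv_out n a2) !raddf0 !scale0r.
  have a2' : (a <= ab.2)%O by move: a2; rewrite in_itv andbT.
  rewrite itv_coord_tr // ?in_itv /= ?(le_trans a2') // total_tr_tr //.
  by rewrite -lm; apply: le_trans i2; apply: l_mono; apply: le_trans h2.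
move=> v0; have := tensor_liftE bl br b_tr rep_below v (itv_gen _ _ _).
rewrite -/(rep_ins v) v0 raddf0 /b itv_coord_gen ?scale1r ?total_tr_id //.
by rewrite in_itv /= lexx.
Qed.
End Point.

Hypothesis l_adj : forall x, (forall s, ~~ (l s a <= x)%O) \/
  exists m, forall s, (l s a <= x)%O = (s <= m)%O.

(** At each point the functor is either zero or the evaluation at some m, and
    both are exact. *)
Lemma tensor_exact_rep (A B C : pmod k T) (f : pmor A B) (g : pmor B C) :
  (forall x b, g x b = 0 -> exists a, f x a = b) ->
  forall x u, tensor_map l g (pm_fid rep) x u = 0 ->
    exists v, tensor_map l f (pm_fid rep) x v = u.
Proof.
move=> fg x u; have [la|[m lm]] := l_adj x.
  move=> _; exists 0; rewrite raddf0; apply/esym.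
  have eq0P c (v w : tensor l B rep x) : v = 0 -> w = 0 -> c *: v + w = 0.
    by move=> -> ->; rewrite scaler0 addr0.
  move: u; apply: (tensor_spanned (W := Subspace (erefl : 0 = 0 :> tensor l B rep x) eq0P)).
  move=> ab i v n /=; rewrite (itv_out n) ?pure_tensor0r // in_itv /= andbT.
  apply: contra (la ab.1) => a2; apply: le_trans i; exact: l_mono.
have [v ->] := rep_ins_surj lm u.
rewrite [LHS]tensor_mapE => gv; have /fg[w fw] := rep_ins_inj (lm := lm) gv.
by exists (rep_ins lm w); rewrite [LHS]tensor_mapE fw.
Qed.
End RepFlat.

(** A projective module is its own resolution. *)
Lemma Tor_rep (T : porderType d) l (a : T) (N : pmod k T) j :
  (1 <= j)%N -> pm_zero (Tor l j (itv_mod k `[a, +oo[) N).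
Proof.
have Pa : pm_projective (itv_mod k `[a, +oo[) := @rep_projective _ _ _ _.
have P0 := pm_zero_projective (@zero_pmodE k d T).
set rep := itv_mod k _ in Pa *.
have id_epi : pm_epi (pm_fid rep) by move=> x n; exists n.
have id_exact : pm_exact (pm_fzero (zero_pmod k T) rep) (pm_fid rep).
  by move=> x b; split=> [b0|[_ <-]//]; exists 0; rewrite [RHS]b0.
have z_inj x p : pm_fzero (zero_pmod k T) rep x p = 0 -> p = 0 by move=> _; apply: zero_pmodE.
case: j => [|[|j]] // _; last first.
  exact: (Tor_ge2_two_term P0 Pa id_epi id_exact z_inj (isT : (2 <= j.+2)%N)).
apply: pm_zero_iso (Tor1_two_term P0 Pa id_epi id_exact z_inj l N) _.
apply: homology_zero => x b _; exists 0; rewrite raddf0 [b]tensor_zero //; exact: zero_pmodE.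
Qed.
End Flatness.

(** * The p-norm *)

Section PNormOrder.
Variables (R : realType) (p : R).
Hypothesis p_gt0 : 0 < p.
Local Notation l := (pnorm p%:E).

Lemma pnorm_le (s t x : {nonneg R}) :
  (l s t <= x) = (s%:num `^ p + t%:num `^ p <= x%:num `^ p).
Proof.
rewrite -[l s t <= x]/((s%:num `^ p + t%:num `^ p) `^ p^-1 <= x%:num).
have st0 : 0 <= s%:num `^ p + t%:num `^ p by rewrite addr_ge0 ?powR_ge0.
have nn (r : R) : 0 <= r -> r \in Num.nneg by rewrite nnegrE.
have pK (y : R) : 0 <= y -> y = (y `^ p) `^ p^-1.
  by move=> y0; rewrite -powRrM mulfV ?gt_eqF // powRr1.
have Kp (y : R) : 0 <= y -> (y `^ p^-1) `^ p = y.
  by move=> y0; rewrite -powRrM mulVf ?gt_eqF // powRr1.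
apply/idP/idP => h.
  rewrite -[X in X <= _]Kp //; apply: ge0_ler_powR; rewrite ?nn ?powR_ge0 //.
  exact: ltW.
rewrite [leRHS]pK //; apply: ge0_ler_powR; rewrite ?nn ?powR_ge0 //.
by rewrite invr_ge0 ltW.
Qed.

Lemma powR_le (s t : {nonneg R}) : (s%:num `^ p <= t%:num `^ p) = (s <= t).
Proof.
rewrite -[s <= t]/(s%:num <= t%:num); apply/idP/idP; last first.
  by apply: ge0_ler_powR; rewrite ?nnegrE ?ge0 ?(ltW p_gt0).
by apply: contraLR; rewrite -!ltNge; apply: gt0_ltr_powR; rewrite ?nnegrE ?ge0.
Qed.

Lemma pnorm_mono (s s' t t' : {nonneg R}) : s <= s' -> t <= t' -> l s t <= l s' t'.
Proof.
move=> ss tt; rewrite pnorm_le.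
have := lexx (l s' t'); rewrite pnorm_le; apply: le_trans.
by apply: lerD; rewrite powR_le.
Qed.

(** The greatest s with norm at most x is (x^p - a^p)^(1/p), if a <= x. *)
Lemma pnorm_adj (a x : {nonneg R}) : (forall s, ~~ (l s a <= x)) \/
  exists m, forall s, (l s a <= x) = (s <= m).
Proof.
have [ax|ax] := leP (a%:num `^ p) (x%:num `^ p); last first.
  left=> s; rewrite pnorm_le -ltNge; apply: lt_le_trans ax _.
  by rewrite lerDr powR_ge0.
right; have xa0 : 0 <= x%:num `^ p - a%:num `^ p by rewrite subr_ge0.
exists (NngNum (powR_ge0 (x%:num `^ p - a%:num `^ p) p^-1)) => s.
rewrite pnorm_le -powR_le /= -powRrM mulVf ?gt_eqF // powRr1 //.
by rewrite lerBrDr.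
Qed.
End PNormOrder.

Lemma lpc_inf_le (R : realType) n (a b x : n.-tupleprod {nonneg R}) :
  (lpc +oo%E a b <= x)%O = (a <= x)%O && (b <= x)%O.
Proof.
rewrite !Order.TupleProdOrder.leEtprod; apply/forallP/andP.
  move=> h; split; apply/forallP => i; have := h i;
  by rewrite tnth_mktuple /= ge_max => /andP[].
move=> [/forallP ha /forallP hb] i.
by rewrite tnth_mktuple /= ge_max ha hb.
Qed.

Theorem proposition4p30 (R : realType) (k : fieldType) (p : R) (hp : 0 < p) :
  (forall a b c d : {nonneg R}, a < b -> c < d ->
     pm_iso
       (Tor (pnorm p%:E) 1 (itv_mod k `[a, b[) (itv_mod k `[c, d[))
       (itv_mod k `[Order.max (pnorm p%:E b c) (pnorm p%:E a d),
                    pnorm p%:E b d[)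
     /\ forall i : nat, (2 <= i)%N ->
          pm_zero (Tor (pnorm p%:E) i (itv_mod k `[a, b[) (itv_mod k `[c, d[)))
  /\
  (forall (i : nat) (a : {nonneg R}) (M : pmod k {nonneg R}), (1 <= i)%N ->
     pm_zero (Tor (pnorm p%:E) i (itv_mod k `[a, +oo[) M)
     /\ pm_zero (Tor (pnorm p%:E) i M (itv_mod k `[a, +oo[)))
  /\
  (forall (n i : nat) (M N : pmod k (n.-tupleprod {nonneg R})), (1 <= i)%N ->
     pm_zero (Tor (@lpc R +oo%E n) i M N)).
Proof.
split; [|split].
- move=> a b c d ab cd.
  exact: (Tor_interval k (pnorm_mono hp) cd ab).
- move=> i a M i1; split; first exact: Tor_rep.
  apply: Tor_flat => // A B C f g; apply: tensor_exact_rep.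
    by move=> s t t' tt; apply: pnorm_mono.
  exact: pnorm_adj.
- move=> n i M N i1; apply: Tor_flat => // A B C f g.
  apply: tensor_exact_join; exact: lpc_inf_le.
Qed.
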